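(* Let $K$ be a number field and $E/K$ an elliptic curve with full $2$-torsion over $K$ and discriminant $\Delta$. Assume that the image of the $2$-adic representation $\rho_{E,2^\infty}:G_K\to V_1(2)$ surjects onto $V_1(2)/V_2(2)$. Suppose there exists a prime $\mathfrak{p}\subset\mathcal{O}_K$ not dividing $2\Delta$ such that $\#(\mathcal{O}_K/\mathfrak{p})\equiv5\pmod 8$ and the reduction of $E$ modulo $\mathfrak{p}$ has full $4$-torsion over $\mathcal{O}_K/\mathfrak{p}$. Then the $2$-adic Galois representation associated to $E$ has maximal image, i.e. $\rho_{E,2^\infty}(G_K)=V_1(2)$.
   Context: $G_K=\mathrm{Gal}(\overline K/K)$; $\rho_{E,2^\infty}:G_K\to\mathrm{GL}_2(\mathbb{Z}_2)$ is the representation on the $2$-adic Tate module of $E$ (in a chosen basis). $V_k(2)=I+2^k\mathrm{Mat}_{2\times2}(\mathbb{Z}_2)$. Since $E$ has full $2$-torsion over $K$, the image of $\rho_{E,2^\infty}$ lies in $V_1(2)$. Having full $4$-torsion over a field $k$ means that all of the $4$-torsion points of the curve are defined over $k$. *)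

(* Defs.v *)
From HB Require Import structures.
From mathcomp Require Import all_boot all_order all_algebra all_field.
From mathcomp Require Import boolp classical_sets.

Set Implicit Arguments.
Unset Strict Implicit.
Unset Printing Implicit Defensive.

Import GRing.Theory.
Local Open Scope ring_scope.

(* Z_2 is the inverse limit of the rings Z/2^n, n >= 1.  The index is shifted
   because 'Z_m is Z/m only for m > 1: [z2_res a n] is the residue of [a]
   modulo 2^(n+1). *)
Definition coherent (u : forall n : nat, 'Z_(2 ^ n.+1)) : Prop :=
  forall n : nat, u n.+1 = u n %[mod 2 ^ n.+1].

Record Z2 := MkZ2 {
  z2_res : forall n : nat, 'Z_(2 ^ n.+1);
  z2_coh : coherent z2_res }.

Lemma Zp_trunc2 n : (Zp_trunc (2 ^ n.+1)).+2 = (2 ^ n.+1)%N.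
Proof. by rewrite Zp_cast // (@ltn_exp2l 2 0). Qed.

Lemma Z2P (a b : Z2) : z2_res a = z2_res b -> a = b.
Proof.
case: a b => [u hu] [v hv] /= e; case: _ / e hv => hv.
by congr MkZ2; apply: Prop_irrelevance.
Qed.

Lemma Z2_eqP (a b : Z2) : (forall n, z2_res a n = z2_res b n) -> a = b.
Proof. by move=> e; apply/Z2P/functional_extensionality_dep. Qed.

Fact z2_mod n m : m %% (Zp_trunc (2 ^ n.+2)).+2 = m %[mod 2 ^ n.+1].
Proof.
by rewrite Zp_trunc2 modn_dvdm // [X in (_ %| X)%N]expnS dvdn_mull. Qed.

Fact z2_mod1 n m : m %% (Zp_trunc (2 ^ n.+1)).+2 = m %[mod 2 ^ n.+1].
Proof. by rewrite Zp_trunc2 modn_mod. Qed.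

Fact z2_zero_coh : coherent (fun=> 0).
Proof. by []. Qed.

Fact z2_one_coh : coherent (fun=> 1).
Proof. by move=> n; apply: (etrans (z2_mod n 1)); rewrite (z2_mod1 n 1). Qed.

Fact z2_opp_coh (a : Z2) : coherent (fun n => - z2_res a n).
Proof.
move=> n; rewrite z2_mod z2_mod1.
have := z2_coh a n; have := ltnW (ltn_ord (z2_res a n)).
have := ltnW (ltn_ord (z2_res a n.+1)).
move: (nat_of_ord (z2_res a n)) (nat_of_ord (z2_res a n.+1)) => x y.
rewrite !Zp_trunc2 => ley lex exy.
apply/eqP; rewrite -(eqn_modDr x) subnK // -modnDmr -exy modnDmr subnK //.
by rewrite modnn [X in (X %% _)%N]expnS modnMl.
Qed.

Fact z2_add_coh (a b : Z2) : coherent (fun n => z2_res a n + z2_res b n).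
Proof.
move=> n; rewrite z2_mod z2_mod1.
by apply/eqP; rewrite -modnDm (z2_coh a) (z2_coh b) modnDm.
Qed.

Fact z2_mul_coh (a b : Z2) : coherent (fun n => z2_res a n * z2_res b n).
Proof.
move=> n; rewrite z2_mod z2_mod1.
by apply/eqP; rewrite -modnMm (z2_coh a) (z2_coh b) modnMm.
Qed.

Definition z2_zero := MkZ2 z2_zero_coh.
Definition z2_one := MkZ2 z2_one_coh.
Definition z2_opp a := MkZ2 (z2_opp_coh a).
Definition z2_add a b := MkZ2 (z2_add_coh a b).
Definition z2_mul a b := MkZ2 (z2_mul_coh a b).

HB.instance Definition _ := gen_eqMixin Z2.
HB.instance Definition _ := gen_choiceMixin Z2.

Fact z2_addA : associative z2_add.
Proof. by move=> a b c; apply: Z2_eqP => n; exact: addrA. Qed.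
Fact z2_addC : commutative z2_add.
Proof. by move=> a b; apply: Z2_eqP => n; exact: addrC. Qed.
Fact z2_add0 : left_id z2_zero z2_add.
Proof. by move=> a; apply: Z2_eqP => n; exact: add0r. Qed.
Fact z2_addN : left_inverse z2_zero z2_opp z2_add.
Proof. by move=> a; apply: Z2_eqP => n; exact: addNr. Qed.

HB.instance Definition _ :=
  GRing.isZmodule.Build Z2 z2_addA z2_addC z2_add0 z2_addN.

Fact z2_mulA : associative z2_mul.
Proof. by move=> a b c; apply: Z2_eqP => n; exact: mulrA. Qed.
Fact z2_mulC : commutative z2_mul.
Proof. by move=> a b; apply: Z2_eqP => n; exact: mulrC. Qed.
Fact z2_mul1 : left_id z2_one z2_mul.
Proof. by move=> a; apply: Z2_eqP => n; exact: mul1r. Qed.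
Fact z2_mulD : left_distributive z2_mul z2_add.
Proof. by move=> a b c; apply: Z2_eqP => n; exact: mulrDl. Qed.
Fact z2_one_neq0 : z2_one != 0 :> Z2.
Proof. by apply/eqP => /(congr1 (fun a => z2_res a 0)). Qed.

HB.instance Definition _ := GRing.Zmodule_isComNzRing.Build Z2
  z2_mulA z2_mulC z2_mul1 z2_mulD z2_one_neq0.

(* V_k(2) = I + 2^k Mat_2(Z_2) *)
Definition V2 (k : nat) : set 'M[Z2]_2 :=
  [set 1%:M + 2 ^+ k *: X | X in [set: 'M[Z2]_2]]%classic.

Definition integer_pred (K : fieldExtType rat) : {pred K} :=
  fun x => `[< integralOver (intr : int -> K) x >].
Arguments integer_pred K : clear implicits.

Lemma integer_predP (K : fieldExtType rat) (x : K) :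
  reflect (integralOver (intr : int -> K) x) (x \in integer_pred K).
Proof. exact: asboolP. Qed.

Fact integer_subring_closed (K : fieldExtType rat) :
  subring_closed (integer_pred K).
Proof.
split; first by apply/integer_predP; apply: (@integral1 int K intr).
- move=> x y /integer_predP ix /integer_predP iy.
  by apply/integer_predP; apply: (@integral_sub int K intr).
- move=> x y /integer_predP ix /integer_predP iy.
  by apply/integer_predP; apply: (@integral_mul int K intr).
Qed.

HB.instance Definition _ (K : fieldExtType rat) :=
  GRing.isSubringClosed.Build K (integer_pred K) (@integer_subring_closed K).

Record ring_of_integers (K : fieldExtType rat) :=
  MkInteger { integer_val :> K; integer_valP : integer_val \in integer_pred K }.

HB.instance Definition _ (K : fieldExtType rat) :=
  [isSub of ring_of_integers K for @integer_val K].
HB.instance Definition _ (K : fieldExtType rat) :=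
  [Choice of ring_of_integers K by <:].
HB.instance Definition _ (K : fieldExtType rat) :=
  [SubChoice_isSubComNzRing of ring_of_integers K by <:].

Definition nonzero_prime (R : comNzRingType) (p : {pred R}) : Prop :=
  [/\ idealr_closed p, prime_idealr_closed p & exists2 x, x \in p & x != 0].

(* [red] identifies k with the residue ring R / p. *)
Definition residue_map (R : comNzRingType) (p : {pred R}) (k : nzRingType)
    (red : {rmorphism R -> k}) : Prop :=
  (forall y : k, exists x : R, red x = y) /\
  (forall x : R, (red x == 0) = (x \in p)).

(* y^2 + a1 x y + a3 y = x^3 + a2 x^2 + a4 x + a6 *)
Record weierstrass (R : Type) :=
  Weierstrass { a1 : R; a2 : R; a3 : R; a4 : R; a6 : R }.

Definition map_weierstrass (R S : Type) (f : R -> S) (E : weierstrass R) :=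
  Weierstrass (f (a1 E)) (f (a2 E)) (f (a3 E)) (f (a4 E)) (f (a6 E)).

Definition discriminant (R : comNzRingType) (E : weierstrass R) : R :=
  let b2 := a1 E ^+ 2 + 4%:R * a2 E in
  let b4 := 2%:R * a4 E + a1 E * a3 E in
  let b6 := a3 E ^+ 2 + 4%:R * a6 E in
  let b8 := a1 E ^+ 2 * a6 E + 4%:R * a2 E * a6 E - a1 E * a3 E * a4 E
            + a2 E * a3 E ^+ 2 - a4 E ^+ 2 in
  - b2 ^+ 2 * b8 - 8%:R * b4 ^+ 3 - 27%:R * b6 ^+ 2 + 9%:R * b2 * b4 * b6.

Definition elliptic (F : fieldType) (E : weierstrass F) : Prop :=
  discriminant E != 0.

(* E' arises from E by x = u^2 x' + r, y = u^3 y' + u^2 s x' + t. *)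
Definition weierstrass_iso (F : fieldType) (E E' : weierstrass F) : Prop :=
  exists u r s t : F, u != 0 /\
  [/\ u * a1 E' = a1 E + 2%:R * s,
      u ^+ 2 * a2 E' = a2 E - s * a1 E + 3%:R * r - s ^+ 2,
      u ^+ 3 * a3 E' = a3 E + r * a1 E + 2%:R * t,
      u ^+ 4 * a4 E' = a4 E - s * a3 E + 2%:R * r * a2 E
                       - (t + r * s) * a1 E + 3%:R * r ^+ 2 - 2%:R * s * t
    & u ^+ 6 * a6 E' = a6 E + r * a4 E + r ^+ 2 * a2 E + r ^+ 3
                       - t * a3 E - t ^+ 2 - r * t * a1 E].

(* [None] is the point at infinity. *)
Definition ecpoint (F : Type) : Type := option (F * F).

Definition map_point (F L : Type) (f : F -> L) : ecpoint F -> ecpoint L :=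
  omap (fun P => (f P.1, f P.2)).

Section GroupLaw.

Variables (F : fieldType) (E : weierstrass F).

Definition on_curve (P : ecpoint F) : bool :=
  if P is Some (x, y) then
    y ^+ 2 + a1 E * x * y + a3 E * y
      == x ^+ 3 + a2 E * x ^+ 2 + a4 E * x + a6 E
  else true.

(* The line through P and Q (the tangent if P = Q) is y = l x + nu. *)
Definition add_point (P Q : ecpoint F) : ecpoint F :=
  match P, Q with
  | None, _ => Q
  | _, None => P
  | Some (x1, y1), Some (x2, y2) =>
    if (x1 == x2) && (y1 + y2 + a1 E * x2 + a3 E == 0) then None
    else
      let l := if x1 == x2 then
          (3%:R * x1 ^+ 2 + 2%:R * a2 E * x1 + a4 E - a1 E * y1)
            / (2%:R * y1 + a1 E * x1 + a3 E)
        else (y2 - y1) / (x2 - x1) in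
      let nu := y1 - l * x1 in
      let x3 := l ^+ 2 + a1 E * l - a2 E - x1 - x2 in
      Some (x3, - (l + a1 E) * x3 - nu - a3 E)
  end.

Definition mul_point (n : nat) (P : ecpoint F) : ecpoint F :=
  iter n (add_point P) None.

Definition torsion_point (n : nat) (P : ecpoint F) : Prop :=
  on_curve P /\ mul_point n P = None.

End GroupLaw.

(* Every n-torsion point over an algebraic closure of F is F-rational. *)
Definition full_torsion (F : fieldType) (E : weierstrass F) (n : nat) : Prop :=
  forall (L : closedFieldType) (j : {rmorphism F -> L}), integralRange j ->
  forall P : ecpoint L, torsion_point (map_weierstrass j E) n P ->
  exists2 Q : ecpoint F, on_curve E Q & map_point j Q = P.

Section TateModule.

Variables (F : fieldType) (E : weierstrass F).

(* t n is a 2^n-torsion point; t 0 is the point at infinity. *)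
Definition tate_module (t : nat -> ecpoint F) : Prop :=
  t 0 = None /\
  forall n, on_curve E (t n) /\ mul_point E 2 (t n.+1) = t n.

(* The residue of a modulo 2^(n+1) acts on the 2^n-torsion point t n. *)
Definition tate_scale (a : Z2) (t : nat -> ecpoint F) (n : nat) : ecpoint F :=
  mul_point E (z2_res a n) (t n).

Definition tate_add (t u : nat -> ecpoint F) (n : nat) : ecpoint F :=
  add_point E (t n) (u n).

Definition tate_comb (e : 'I_2 -> nat -> ecpoint F) (c : 'cV[Z2]_2) :=
  tate_add (tate_scale (c 0 0) (e 0)) (tate_scale (c 1 0) (e 1)).

Definition tate_basis (e : 'I_2 -> nat -> ecpoint F) : Prop :=
  (forall i, tate_module (e i)) /\
  (forall t, tate_module t -> exists! c : 'cV[Z2]_2, tate_comb e c = t).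

Definition tate_coord (e : 'I_2 -> nat -> ecpoint F) (t : nat -> ecpoint F)
    : 'cV[Z2]_2 :=
  xget 0 [set c | tate_comb e c = t]%classic.

End TateModule.

Section GaloisRepresentation.

(* algC is an algebraic closure of K through the embedding iota. *)
Variables (K : fieldExtType rat) (iota : {rmorphism K -> algC}).

Definition abs_galois : set {rmorphism algC -> algC} :=
  [set s : {rmorphism algC -> algC} |
     bijective s /\ forall x : K, s (iota x) = iota x]%classic.

(* Column j of the matrix holds the coordinates of s (e j) in the basis e. *)
Definition galois_rep (E : weierstrass K) (e : 'I_2 -> nat -> ecpoint algC)
    (s : {rmorphism algC -> algC}) : 'M[Z2]_2 :=
  \matrix_(i, j)
    tate_coord (map_weierstrass iota E) e (fun n => map_point s (e j n)) i 0.

End GaloisRepresentation.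

(* Main.v *)
(* The image is a subgroup of V_1(2), and it is closed: along an ultrafilter a
   sequence of automorphisms of algC converges pointwise, every algebraic number
   having finitely many conjugates.  Since the square of 1 + 2A is
   1 + 4(A + A^2) modulo 8, surjectivity onto V_1/V_2 yields all 1 + 4X modulo 8
   with X of even trace; for k >= 2 squaring maps V_k/V_(k+1) onto
   V_(k+1)/V_(k+2).  So everything follows from one element 1 + 4X of the image
   with X of odd trace.

   Such an element is found without Frobenius elements or the Weil pairing.
   Let u, v, w be the roots of the 2-division polynomial, and a, b, c square
   roots of u - v, u - w, v - w.  Any automorphism that fixes i, a, b, c and
   negates sqrt(2) will do.
     It fixes E[4], which is rational over K(i, a, b, c).
   Let (P0, P1) be the basis of E[4] with 2 P0 = (u, _) and 2 P1 = (v, _), let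
   2 Qj = Pj, and let r_t(Q) be the square root of x(2Q) - t that is a rational
   function of Q.  Translating Q by (t, _) preserves r_t and translating it by
   another point of order 2 negates it, so rho = r_v(Q0) r_u(Q1) is multiplied
   by (-1)^(tr X).  But rho = i a (a + b - i c) / sqrt(2) up to sign.

   If there were no such automorphism, then by Kummer theory 2 times a product
   of powers of -1, u - v, u - w, v - w would be a square in K.  Full 4-torsion
   of the reduction makes -1 and these differences squares in the residue field
   of cardinal q, so 2 would be a square there, which q = 5 mod 8 forbids.

   Associativity of the addition on a Weierstrass curve comes from mapping a
   point to the class of its maximal ideal in the coordinate ring. *)

Require Import Defs.
From HB Require Import structures.
From mathcomp Require Import all_boot all_order all_algebra all_field.
From mathcomp Require Import boolp classical_sets filter ring zify.

Set Implicit Arguments.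
Unset Strict Implicit.
Unset Printing Implicit Defensive.

Import GRing.Theory.
Local Open Scope ring_scope.
Local Open Scope classical_set_scope.

(** * Ideals and ideal classes *)

Section IdealProduct.
Variable R : comNzRingType.
Implicit Types (A B C : R -> Prop) (a b c r : R).

Definition is_ideal A : Prop :=
  [/\ A 0, forall a b, A a -> A b -> A (a + b) & forall r a, A a -> A (r * a)].

(* Impredicatively, the least ideal containing all the products. *)
Definition idealM A B : R -> Prop := fun r =>
  forall I, is_ideal I -> (forall a b, A a -> B b -> I (a * b)) -> I r.

Definition principal r : R -> Prop := fun x => exists c, x = r * c.

Lemma idealM_ideal A B : is_ideal (idealM A B).
Proof.
split=> [I [] // |a b ha hb I hI h|r a ha I hI h].
- by case: (hI) => _ + _; apply; [exact: ha|exact: hb].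
- by case: (hI) => _ _; apply; exact: ha.
Qed.

Lemma idealM_mem A B a b : A a -> B b -> idealM A B (a * b).
Proof. by move=> ha hb I _; apply. Qed.

Lemma idealM_sub A B I : is_ideal I ->
  (forall a b, A a -> B b -> I (a * b)) -> forall r, idealM A B r -> I r.
Proof. by move=> hI h r; apply. Qed.

(** Allows the least-ideal property of a product to be applied to one factor while the other factors
    stay fixed. *)
Lemma colon_ideal (I : R -> Prop) (c : R) :
  is_ideal I -> is_ideal (fun r => I (r * c)).
Proof.
case=> I0 ID IM; split=> [|a b ha hb|r a ha]; first by rewrite mul0r.
  by rewrite mulrDl; apply: ID.
by rewrite -mulrA; apply: IM.
Qed.

Lemma principal_ideal r : is_ideal (principal r).
Proof.
split=> [|a b [c ->] [d ->]|s a [c ->]]; first by exists 0; rewrite mulr0.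
  by exists (c + d); rewrite mulrDr.
by exists (s * c); rewrite mulrCA.
Qed.

Lemma idealMC A B : idealM A B = idealM B A.
Proof.
by apply: funext => r; apply/propext; split; apply: idealM_sub;
  try exact: idealM_ideal; move=> a b ha hb; rewrite mulrC; apply: idealM_mem.
Qed.

Lemma idealM_subA A B C r :
  idealM (idealM A B) C r -> idealM A (idealM B C) r.
Proof.
move: r; apply: idealM_sub; first exact: idealM_ideal.
move=> x c hx hc; move: x hx; apply: idealM_sub.
  exact/colon_ideal/idealM_ideal.
by move=> a b ha hb; rewrite -mulrA; do 2!apply: idealM_mem => //.
Qed.

Lemma idealMA A B C : idealM A (idealM B C) = idealM (idealM A B) C.
Proof.
apply: funext => r; apply/propext; split; last exact: idealM_subA.
rewrite [idealM A _]idealMC [idealM B C]idealMC => /idealM_subA.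
by rewrite [idealM C _]idealMC [idealM B A]idealMC.
Qed.

Lemma idealM_principal r A : is_ideal A ->
  idealM (principal r) A = fun x => exists2 a, A a & x = r * a.
Proof.
case=> A0 AD AM; apply: funext => x; apply/propext; split.
  move: x; apply: idealM_sub.
    split=> [|_ _ [a ha ->] [b hb ->]|s _ [a ha ->]].
    - by exists 0; rewrite ?mulr0.
    - by exists (a + b); rewrite ?mulrDr //; apply: AD.
    - by exists (s * a); rewrite 1?mulrCA //; apply: AM.
  by move=> _ b [c ->] hb; exists (c * b); rewrite ?mulrA //; apply: AM.
by case=> a ha ->; apply: idealM_mem => //; exists 1; rewrite mulr1.
Qed.

Lemma principalM r s :
  idealM (principal r) (principal s) = principal (r * s).
Proof.
rewrite idealM_principal; last exact: principal_ideal.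
apply: funext => x; apply/propext; split.
  by case=> _ [c ->] ->; exists c; rewrite mulrA.
by case=> c ->; exists (s * c); rewrite ?mulrA //; exists c.
Qed.

Lemma idealM1 A : is_ideal A -> idealM A (principal 1) = A.
Proof.
move=> hA; rewrite idealMC idealM_principal //.
apply: funext => x; apply/propext; split=> [[a ha ->]|hx];
  first by rewrite mul1r.
by exists x; rewrite ?mul1r.
Qed.

End IdealProduct.

Section IdealClass.
Variable R : comNzRingType.
Hypothesis domR : forall a b : R, a * b = 0 -> a = 0 \/ b = 0.
Implicit Types (A B C : R -> Prop) (a b c r : R).

(** Equality in the ideal class group, cleared of denominators so that no fractional ideals
    occur. *)
Definition class_eq A B : Prop := exists g h : R,
  [/\ g <> 0, h <> 0 & idealM (principal g) A = idealM (principal h) B].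

Lemma class_eq_sym A B : class_eq A B -> class_eq B A.
Proof. by case=> g [h [g0 h0 e]]; exists h, g. Qed.

Lemma class_eq_trans A B C : class_eq A B -> class_eq B C -> class_eq A C.
Proof.
case=> g [h [g0 h0 e]] [g' [h' [g0' h0' e']]].
exists (g' * g), (h * h'); split; try by move/domR => [].
rewrite -!principalM -!idealMA e -e' !idealMA.
by rewrite [idealM _ (principal h)]idealMC.
Qed.

Lemma class_eqM A B C : class_eq A B -> class_eq (idealM A C) (idealM B C).
Proof.
by case=> g [h [g0 h0 e]]; exists g, h; split=> //; rewrite !idealMA e.
Qed.

(** From g A = (h) one gets h = g b with b in A; cancelling g shows that b generates A. *)
Lemma class_eq_principal A : is_ideal A -> class_eq A (principal 1) ->
  exists g, A = principal g.
Proof.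
move=> hA [g [h [g0 h0]]]; rewrite idealM_principal // principalM mulr1 => e.
have ee x : (exists2 a, A a & x = g * a) <-> principal h x by rewrite -e.
have [b Ab hb] : exists2 a, A a & h = g * a.
  by apply/ee; exists 1; rewrite mulr1.
exists b; apply: funext => a; apply/propext; split=> [Aa|[c ->]]; last first.
  by case: hA => _ _ hA; rewrite mulrC; apply: hA.
have [c hc] : principal h (g * a) by apply/ee; exists a.
exists c; apply/eqP; rewrite -subr_eq0; apply/eqP.
have /domR [] // : g * (a - b * c) = 0.
by rewrite mulrBr hc hb mulrA subrr.
Qed.

End IdealClass.

(** * The coordinate ring and the group law *)

(* [(u, v)] stands for [u + v y], where [y^2 = wcub - wlin * y]. *)
Definition coord_ring (F : fieldType) (E : weierstrass F) : Type :=
  ({poly F} * {poly F})%type.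
HB.instance Definition _ (F : fieldType) (E : weierstrass F) :=
  GRing.Zmodule.on (coord_ring E).

Section CoordinateRing.
Variables (F : fieldType) (E : weierstrass F).

Definition wlin : {poly F} := a1 E *: 'X + (a3 E)%:P.
Definition wcub : {poly F} :=
  'X^3 + a2 E *: 'X^2 + a4 E *: 'X + (a6 E)%:P.

Local Notation coord_ring := (coord_ring E).

Definition coord_mul (p q : coord_ring) : coord_ring :=
  (p.1 * q.1 + wcub * p.2 * q.2, p.1 * q.2 + p.2 * q.1 - wlin * p.2 * q.2).

Fact coord_mulA : associative coord_mul.
Proof.
by move=> [p p'] [q q'] [r r']; rewrite /coord_mul /=; congr pair; ring.
Qed.
Fact coord_mulC : commutative coord_mul.
Proof. by move=> [p p'] [q q']; rewrite /coord_mul /=; congr pair; ring. Qed.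
Fact coord_mul1 : left_id ((1, 0) : coord_ring) coord_mul.
Proof. by move=> [p p']; rewrite /coord_mul /=; congr pair; ring. Qed.
Fact coord_mulD : left_distributive coord_mul +%R.
Proof.
move=> [p p'] [q q'] [r r']; rewrite /coord_mul.
by apply/eqP/andP; split; apply/eqP => /=; ring.
Qed.
Fact coord_one_neq0 : ((1, 0) : coord_ring) != 0.
Proof. by apply/eqP => -[] /eqP; rewrite oner_eq0. Qed.

HB.instance Definition _ := GRing.Zmodule_isComNzRing.Build coord_ring
  coord_mulA coord_mulC coord_mul1 coord_mulD coord_one_neq0.

Lemma coordP (a b : coord_ring) : a.1 = b.1 -> a.2 = b.2 -> a = b.
Proof. by case: a b => [? ?] [? ?] /= -> ->. Qed.
Lemma coordM1 (a b : coord_ring) : (a * b).1 = a.1 * b.1 + wcub * a.2 * b.2.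
Proof. by []. Qed.
Lemma coordM2 (a b : coord_ring) :
  (a * b).2 = a.1 * b.2 + a.2 * b.1 - wlin * a.2 * b.2.
Proof. by []. Qed.
Lemma coordD1 (a b : coord_ring) : (a + b).1 = a.1 + b.1.
Proof. by []. Qed.
Lemma coordD2 (a b : coord_ring) : (a + b).2 = a.2 + b.2.
Proof. by []. Qed.
Lemma coordN1 (a : coord_ring) : (- a).1 = - a.1.
Proof. by []. Qed.
Lemma coordN2 (a : coord_ring) : (- a).2 = - a.2.
Proof. by []. Qed.
Definition coordE := (coordM1, coordM2, coordD1, coordD2, coordN1, coordN2).

(** The norm to F[x]: the product of u + v y with its conjugate under y -> - y - [wlin]. *)
Definition coord_norm (a : coord_ring) : {poly F} :=
  a.1 ^+ 2 - a.1 * a.2 * wlin - a.2 ^+ 2 * wcub.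

Lemma coord_normM a b : coord_norm (a * b) = coord_norm a * coord_norm b.
Proof. by rewrite /coord_norm !coordE; ring. Qed.

(* [size p] elaborates to several convertible forms, which [lia] tells apart. *)
Local Ltac size_lia := change (@size (GRing.Field.sort F)) with
  (@size (GRing.NzSemiRing.sort F)) in *; lia.

Lemma size_mulE (p q : {poly F}) : p != 0 -> q != 0 ->
  size (p * q) = (size p + size q).-1.
Proof. exact: size_mul. Qed.

Lemma size_wlin : (size wlin <= 2)%N.
Proof.
rewrite (leq_trans (size_polyD _ _)) // geq_max (leq_trans (size_scale_leq _
  _)) ?size_polyX //.
by rewrite (leq_trans (size_polyC_leq1 _)).
Qed.

Lemma size_wcub_low :
  (size (a2 E *: 'X^2 + a4 E *: 'X + (a6 E)%:P)%R <= 3)%N.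
Proof.
rewrite (leq_trans (size_polyD _ _)) // geq_max; apply/andP; split; last first.
  by rewrite (leq_trans (size_polyC_leq1 _)).
rewrite (leq_trans (size_polyD _ _)) // geq_max.
by rewrite !(leq_trans (size_scale_leq _ _)) ?size_polyX ?size_polyXn.
Qed.

Lemma size_wcub : size wcub = 4.
Proof.
have := size_wcub_low; rewrite /wcub -!addrA => h.
by rewrite size_polyDl size_polyXn.
Qed.

(** The square of u has even degree and v^2 times the cubic has odd degree, so they cannot cancel,
    and the cross term always has smaller degree than the larger of the two. *)
Lemma size_coord_norm (u v : {poly F}) : u != 0 -> v != 0 ->
  size (coord_norm (u, v)) = maxn ((size u).*2).-1 ((size v).*2).+2.
Proof.
move=> u0 v0; rewrite /coord_norm /=.
have su : (0 < size u)%N by rewrite size_poly_gt0.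
have sv : (0 < size v)%N by rewrite size_poly_gt0.
have s1 : size (u ^+ 2) = ((size u).*2).-1.
  by rewrite expr2 size_mulE //; size_lia.
have s3 : size (v ^+ 2 * wcub) = ((size v).*2).+2.
  have c0 : wcub != 0 by rewrite -size_poly_gt0 size_wcub.
  by rewrite size_mulE ?expf_neq0 // size_wcub expr2 size_mulE //; size_lia.
have s2 : (size (u * v * wlin)%R <= (size u + size v))%N.
  apply: leq_trans (size_polyMleq _ _) _.
  by have := size_wlin; rewrite size_mulE //; size_lia.
have sN (p : {poly F}) : size (- p) = size p by rewrite size_polyN.
have [lt|le] := ltnP (size u) (size v).+2.
  rewrite addrC size_polyDl sN; first by rewrite s3; size_lia.
  rewrite s3; apply: leq_ltn_trans (size_polyD _ _) _.
  by rewrite gtn_max sN s1; size_lia.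
rewrite -addrA size_polyDl; first by rewrite s1; size_lia.
rewrite s1; apply: leq_ltn_trans (size_polyD _ _) _.
by rewrite gtn_max !sN s3; size_lia.
Qed.

Lemma size_coord_norm0 (u : {poly F}) :
  size (coord_norm (u, 0)) = ((size u).*2).-1.
Proof.
have -> : coord_norm (u, 0) = u ^+ 2 by rewrite /coord_norm /=; ring.
have [->|u0] := eqVneq u 0; first by rewrite expr0n /= size_poly0.
by rewrite expr2 size_mulE //; size_lia.
Qed.

Lemma coord_norm_eq0 a : coord_norm a = 0 -> a = 0.
Proof.
case: a => u v h; have: size (coord_norm (u, v)) = 0 by rewrite h size_poly0.
have [v0|v0] := eqVneq v 0.
  rewrite v0 size_coord_norm0 => s; apply: coordP => //=.
  by apply/eqP; rewrite -size_poly_eq0; size_lia.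
have [u0|u0] := eqVneq u 0; last by rewrite size_coord_norm //; size_lia.
have {h} /eqP : - (v ^+ 2 * wcub) = 0.
  by rewrite -h /coord_norm /= u0; ring.
rewrite oppr_eq0 mulf_eq0 expf_eq0 (negbTE v0) /= => /eqP h.
by have := size_wcub; rewrite h size_poly0.
Qed.

Lemma coord_domain (a b : coord_ring) : a * b = 0 -> a = 0 \/ b = 0.
Proof.
move=> h; have /eqP : coord_norm a * coord_norm b = 0.
  by rewrite -coord_normM h /coord_norm; ring.
rewrite mulf_eq0 => /orP [] /eqP /coord_norm_eq0; [by left|by right].
Qed.

Definition coord_eval (x y : F) (a : coord_ring) : F := a.1.[x] + a.2.[x] * y.

(** The point at infinity gets the unit ideal, hence the trivial class. *)
Definition point_ideal (P : ecpoint F) : coord_ring -> Prop :=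
  if P is Some (x, y) then fun a => coord_eval x y a = 0 else principal 1.

Lemma wlinE x : wlin.[x] = a1 E * x + a3 E.
Proof. by rewrite /wlin !hornerE. Qed.

Lemma wcubE x : wcub.[x] = x ^+ 3 + a2 E * x ^+ 2 + a4 E * x + a6 E.
Proof. by rewrite /wcub !hornerE. Qed.

Lemma on_curveE x y : on_curve E (Some (x, y)) =
  (y ^+ 2 + wlin.[x] * y == wcub.[x]).
Proof. by rewrite /on_curve wlinE wcubE; congr (_ == _); ring. Qed.

Lemma coord_evalM x y a b : on_curve E (Some (x, y)) ->
  coord_eval x y (a * b) = coord_eval x y a * coord_eval x y b.
Proof.
rewrite on_curveE /coord_eval !coordE => /eqP /esym.
move: wcub wlin => g w h; rewrite !(hornerD, hornerN, hornerM); ring: h.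
Qed.

Lemma point_ideal_ideal P : on_curve E P -> is_ideal (point_ideal P).
Proof.
case: P => [[x y] h|_]; last exact: principal_ideal.
split=> [|a b /= ha hb|r a /= ha]; rewrite /= ?coord_evalM ?ha ?mulr0 //.
  by rewrite /coord_eval !horner0; ring.
move: ha hb; rewrite /coord_eval => ha hb.
by rewrite !coordE !hornerD mulrDl addrACA ha hb addr0.
Qed.

(* Degree 1 is the one value that the degree of a norm omits. *)
Lemma point_ideal_not_principal x y g : on_curve E (Some (x, y)) ->
  point_ideal (Some (x, y)) <> principal g.
Proof.
move=> hP e.
have mem a : point_ideal (Some (x, y)) a <-> principal g a by rewrite e.
have [b hb] : principal g (('X - x%:P, 0) : coord_ring).
  by apply/mem => /=; rewrite /coord_eval /= !hornerE subrr.
have [c hc] : principal g ((- y%:P, 1) : coord_ring).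
  by apply/mem => /=; rewrite /coord_eval /= !hornerE addNr.
have g1 : coord_eval x y g = 0.
  by apply/(mem g); exists 1; rewrite mulr1.
have N : coord_norm g * coord_norm b = ('X - x%:P) ^+ 2.
  by rewrite -coord_normM -hb /coord_norm /=; ring.
have N0 : coord_norm g * coord_norm b != 0 by rewrite N expf_neq0
  ?polyXsubC_eq0.
have sz : size (coord_norm g * coord_norm b) = 3.
  by rewrite N expr2 size_mulE ?polyXsubC_eq0 // size_XsubC.
move: N0; rewrite mulf_eq0 negb_or => /andP [g0 b0].
have gpos : (0 < size (coord_norm g))%N by rewrite size_poly_gt0.
have bpos : (0 < size (coord_norm b))%N by rewrite size_poly_gt0.
rewrite size_mulE // in sz.
case: g e mem {hb} hc g1 N sz g0 gpos => u v e mem hc g1 N sz g0 gpos.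
(* The norm of g divides (X - x)^2, whereas a nonzero v would give it degree at least 3. *)
have [v0|v0] := eqVneq v 0; last first.
  have v1 : (0 < size v)%N by rewrite size_poly_gt0.
  have [u0|u0] := eqVneq u 0; last first.
    by have := size_coord_norm u0 v0; size_lia.
  have c0 : wcub != 0 by rewrite -size_poly_gt0 size_wcub.
  have : size (coord_norm (u, v)) = ((size v).*2).+2.
    have -> : coord_norm (u, v) = - (v ^+ 2 * wcub).
      by rewrite /coord_norm /= u0; ring.
    rewrite size_polyN.
    by rewrite size_mulE ?expf_neq0 // size_wcub expr2 size_mulE //; size_lia.
  by size_lia.
have u0 : u != 0.
  by apply: contraNneq g0 => u0; rewrite /coord_norm /= u0 v0; apply/eqP; ring.
have [k k0 gk] : exists2 k, k != 0 & u = k%:P.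
  (* The generator also divides y minus a constant, whose coefficient of y is 1. As v = 0, this
     makes u a unit, and a nonzero constant does not vanish at the point. *)
  have e1 : u * c.2 = 1.
    by rewrite -[RHS]/(((- y%:P, 1) : coord_ring).2) hc coordM2 /= v0; ring.
  have e2 : size (u * c.2) = 1 by rewrite e1 size_poly1.
  have c0 : c.2 != 0.
    by apply: contra_eqN e1 => /eqP ->; rewrite mulr0 eq_sym oner_eq0.
  rewrite size_mulE // in e2.
  have ss : size u == 1.
    by move: u0 c0; rewrite -!size_poly_gt0; size_lia.
  by move/size_poly1P: ss => [k ? ?]; exists k.
by move: g1; rewrite /coord_eval /= gk v0 hornerC horner0 mul0r addr0;
  apply/eqP.
Qed.

End CoordinateRing.
Arguments point_ideal {F} E P.

(** An element of J not vanishing at x makes J comaximal with X - x. Multiplying the two resulting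
    expressions of 1 leaves only terms in J, the last one being a multiple of the given product. *)
Lemma split_ideal_unit (F : fieldType) (J : {poly F} -> Prop) (x1 x2 : F) :
    is_ideal J -> J (('X - x1%:P) * ('X - x2%:P)) ->
    (exists2 p, J p & p.[x1] != 0) -> (exists2 p, J p & p.[x2] != 0) -> J 1.
Proof.
case=> J0 JD JM J12.
have inv x p : J p -> p.[x] != 0 ->
    exists q r, J q /\ 1 = q + r * ('X - x%:P).
  move=> Jp px; have /factor_theorem [s hs] : root (p - p.[x]%:P) x.
    by rewrite /root !hornerE subrr.
  exists (p.[x]^-1%:P * p), (- (p.[x]^-1)%:P * s); split; first exact: JM.
  have -> : p = s * ('X - x%:P) + p.[x]%:P by rewrite -hs subrK.
  rewrite !hornerE subrr mulr0 add0r mulrDr -polyCM mulVf //; ring.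
move=> [p1 J1 h1] [p2 J2 h2].
have [q [r [Jq e1]]] := inv _ _ J1 h1; have [q' [r' [Jq' e2]]] := inv _ _ J2 h2.
have -> : 1 = (q' + r' * ('X - x2%:P)) * q + (r * ('X - x1%:P)) * q'
              + r * r' * (('X - x1%:P) * ('X - x2%:P)) :> {poly F}.
  have -> : 1 = (q + r * ('X - x1%:P)) * (q' + r' * ('X - x2%:P)).
    by rewrite -e1 -e2 mulr1.
  ring.
by apply: (JD _ _ (JD _ _ (JM _ _ Jq) (JM _ _ Jq')) (JM _ _ J12)).
Qed.

Section GroupLaw.
Variables (F : fieldType) (E : weierstrass F).
Hypothesis hE : discriminant E != 0.

(** The curve equation and the two partial derivatives can be solved for [a3], [a4] and [a6] without
    division; substituting them makes the discriminant vanish identically, in every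
    characteristic. *)
Lemma smooth_point x y : on_curve E (Some (x, y)) ->
  2%:R * y + a1 E * x + a3 E = 0 ->
  3%:R * x ^+ 2 + 2%:R * a2 E * x + a4 E - a1 E * y = 0 -> False.
Proof.
move: hE; rewrite /discriminant; case: E => b1 b2 b3 b4 b6 /= h /eqP e0 ey ex.
have e3 : b3 = - (2%:R * y + b1 * x) by rewrite -[LHS]subr0 -ey; ring.
have e4 : b4 = b1 * y - 3%:R * x ^+ 2 - 2%:R * b2 * x 
  by rewrite -[LHS]subr0 -ex; ring.
have e6 : b6 = y ^+ 2 + b1 * x * y + b3 * y - (x ^+ 3 + b2 * x ^+ 2 + b4 * x).
  by rewrite e0; ring.
by move/eqP: h; apply; rewrite e6 e4 e3; ring.
Qed.

Lemma deriv_wcub x :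
  (wcub E)^`().[x] = 3%:R * x ^+ 2 + 2%:R * a2 E * x + a4 E.
Proof.
rewrite /wcub !(derivD, derivZ, derivXn, derivX, derivC).
by rewrite !(hornerD, hornerZ, hornerMn, hornerXn, hornerC, hornerX) /=; ring.
Qed.

Definition neg_point (P : ecpoint F) : ecpoint F :=
  if P is Some (x, y) then Some (x, - y - a1 E * x - a3 E) else None.

Lemma neg_on_curve P : on_curve E P -> on_curve E (neg_point P).
Proof. by case: P => // -[x y] /= /eqP e; apply/eqP; rewrite -e; ring. Qed.

Lemma neg_pointK P : neg_point (neg_point P) = P.
Proof. by case: P => // -[x y] /=; congr (Some (_, _)); ring. Qed.

Let pc (p : {poly F}) : coord_ring E := (p, 0).
Let line (m : {poly F}) : coord_ring E := (- m, 1).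

Lemma pcM p q : pc (p * q) = pc p * pc q.
Proof. by apply: coordP; rewrite ?coordE /pc /=; ring. Qed.
Lemma pcD p q : pc (p + q) = pc p + pc q.
Proof. by apply: coordP; rewrite ?coordE /pc /=; ring. Qed.

Lemma pc_ideal I : is_ideal I -> is_ideal (fun p => I (pc p)).
Proof.
case=> I0 ID IM; split=> // [p q hp hq|p q hq]; rewrite ?pcD ?pcM; auto.
Qed.

Lemma point_ideal_gen x y m a : m.[x] = y -> point_ideal E (Some (x, y)) a ->
  exists p, a = pc (p * ('X - x%:P)) + line m * pc a.2.
Proof.
move=> my; rewrite /= /coord_eval => ea.
have /factor_theorem [p hp] : root (a.1 + a.2 * m) x.
  by rewrite /root hornerD hornerM my ea.
exists p; apply: coordP; rewrite ?coordE /pc /line /= -?hp; ring.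
Qed.

Lemma point_ideal_X x y : point_ideal E (Some (x, y)) (pc ('X - x%:P)).
Proof. by rewrite /= /coord_eval /= !hornerE subrr. Qed.

Lemma point_ideal_line x y m : m.[x] = y ->
  point_ideal E (Some (x, y)) (line m).
Proof. by move=> h; rewrite /= /coord_eval /= !hornerE h addNr. Qed.

(** The divisor of X - x is P + (-P). One inclusion follows from generators, as the product of the
    two horizontal lines is a multiple of X - x. For the other, the polynomials J that multiply X -
    x into the product ideal contain X - x and two polynomials whose values at x are, up to sign,
    the partial derivatives; smoothness makes J the unit ideal. *)
Lemma point_idealM_neg x y : on_curve E (Some (x, y)) ->
  idealM (point_ideal E (Some (x, y))) (point_ideal E (neg_point (Some (x, y))))
  = principal (pc ('X - x%:P)).
Proof.
move=> hP; set y' := - y - a1 E * x - a3 E.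
have hP' : on_curve E (Some (x, y')) := neg_on_curve hP.
pose w := a1 E * x + a3 E.
have [G hG] : exists G, wcub E = G * ('X - x%:P) + y%:P ^+ 2 + w%:P * y%:P.
  have /factor_theorem [G hG] : root (wcub E - (wcub E).[x]%:P) x.
    by rewrite /root !hornerE subrr.
  exists G; rewrite -hG; move: hP; rewrite on_curveE wlinE => /eqP <-.
  rewrite /w !(polyCD, polyCM); ring.
have yw : y'%:P = - y%:P - w%:P by rewrite /y' /w !(polyCD, polyCN, polyCM);
  ring.
have hL : wlin E = (a1 E)%:P * ('X - x%:P) + w%:P.
  by rewrite /w /wlin -mul_polyC !(polyCD, polyCM); ring.
pose g : coord_ring E := (G, - (a1 E)%:P).
have prod : line y%:P * line y'%:P = pc ('X - x%:P) * g.
  by apply: coordP; rewrite !coordE /= yw ?hL ?hG; ring.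
apply: funext => r; apply/propext; split.
  move: r; apply: idealM_sub; first exact: principal_ideal.
  move=> a b /point_ideal_gen -/(_ y%:P) [|p ea]; first by rewrite hornerC.
  move=> /point_ideal_gen -/(_ y'%:P) [|q eb]; first by rewrite hornerC.
  exists (pc p * b + line y%:P * pc a.2 * pc q
          + g * pc a.2 * pc b.2).
  move: (pc a.2) (pc b.2) ea eb => u v -> ->; rewrite !pcM; ring: prod.
case=> c ->; set I := idealM _ _.
have [I0 ID IM] : is_ideal I by exact: idealM_ideal.
rewrite mulrC; apply: (IM c).
pose J := fun p => I (pc p * pc ('X - x%:P)).
have hJ : is_ideal J.
  have := colon_ideal (pc ('X - x%:P)) (idealM_ideal (point_ideal E (Some
    (x,y)))
    (point_ideal E (Some (x,y')))).
  by move/pc_ideal.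
suff: J 1 by rewrite /J -pcM mul1r.
have memX := point_ideal_X x y; have memX' := point_ideal_X x y'.
have memL : point_ideal E (Some (x, y)) (line y%:P).
  by apply: point_ideal_line; rewrite hornerC.
have memL' : point_ideal E (Some (x, y')) (line y'%:P).
  by apply: point_ideal_line; rewrite hornerC.
have JX : J ('X - x%:P) by apply: idealM_mem.
have Jc : J ((2%:R * y + a1 E * x + a3 E)%:P).
  rewrite /J; have -> : pc (2%:R * y + a1 E * x + a3 E)%:P * pc ('X - x%:P)
     = pc ('X - x%:P) * line y'%:P + (-1) * (line y%:P * pc ('X - x%:P)).
    by apply: coordP; rewrite !coordE /= /y' !(polyCD, polyCN, polyCM); ring.
  by apply: ID; [exact: idealM_mem|apply: IM; exact: idealM_mem].
have JG : J (G - (a1 E)%:P * y%:P).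
  rewrite /J; have -> : pc (G - (a1 E)%:P * y%:P) * pc ('X - x%:P) =
     line y%:P * line y'%:P + pc (a1 E)%:P * (line y%:P * pc ('X - x%:P)).
    by rewrite prod; apply: coordP; rewrite !coordE /=; ring.
  by apply: ID; [exact: idealM_mem|apply: IM; exact: idealM_mem].
have JU : exists2 p, J p & p.[x] != 0.
  have [n0|n0] := eqVneq (2%:R * y + a1 E * x + a3 E) 0; last first.
    by eexists; [exact: Jc|rewrite hornerC].
  exists (G - (a1 E)%:P * y%:P) => //; apply/eqP => e.
  apply: (smooth_point hP n0); rewrite -{}e.
  have : (wcub E)^`().[x] = (G * ('X - x%:P))^`().[x].
    have -> : G * ('X - x%:P) = wcub E - (y ^+ 2 + w * y)%:P.
      by rewrite hG !(polyCD, polyCM); ring.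
    by rewrite derivB derivC subr0.
  rewrite deriv_wcub derivM derivXsubC !(hornerD, hornerM, hornerN, hornerC).
  rewrite hornerX => ->; rewrite !hornerE; ring.
by apply: (@split_ideal_unit _ _ x x) => //; case: hJ => _ _; apply.
Qed.

Section CollinearPoints.
Variables (l nu x1 x2 x3 : F).
Let m : {poly F} := l%:P * 'X + nu%:P.
Let y x := l * x + nu.
Hypothesis hm : wcub E - m ^+ 2 - wlin E * m =
  ('X - x1%:P) * ('X - x2%:P) * ('X - x3%:P).

Lemma line_horner x : m.[x] = y x.
Proof. by rewrite /m !hornerE. Qed.

Lemma line_on_curve x : (x - x1) * (x - x2) * (x - x3) = 0 ->
  on_curve E (Some (x, y x)).
Proof.
move=> x0; have := congr1 (horner^~ x) hm.
rewrite /wcub /wlin /m !hornerE /= x0 => e.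
rewrite /on_curve eq_sym -subr_eq0 /y; apply/eqP; apply: etrans e; ring.
Qed.

(* Where the line is tangent it is not vertical. *)
Lemma double_point_slope x z t : (x - z) * (x - t) = 0 ->
  ('X - x1%:P) * ('X - x2%:P) * ('X - x3%:P) =
    ('X - x%:P) * ('X - z%:P) * ('X - t%:P) ->
  2%:R * y x + a1 E * x + a3 E != 0.
Proof.
move=> x0 fac; apply/eqP => n0.
have hP : on_curve E (Some (x, y x)).
  apply: line_on_curve; have := congr1 (fun p : {poly F} => p.[x]) fac.
  by rewrite !(hornerM, hornerXsubC) subrr !mul0r.
apply: (smooth_point hP n0).
have := congr1 (fun p : {poly F} => p^`().[x]) hm.
rewrite fac !(derivB, derivM, derivXsubC) !hornerD !hornerN.
rewrite deriv_wcub /wlin /m !(derivD, derivM, derivC, derivX, derivZ) !hornerE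
  /=.
move=> e; have {}e : 3%:R * x * x + 2%:R * a2 E * x + a4 E - a1 E * y x
      = l * (2%:R * y x + a1 E * x + a3 E) + (x - z) * (x - t).
  apply/eqP; rewrite -subr_eq0; move/eqP: e; rewrite -subr_eq0 => /eqP e.
  by apply/eqP; apply: etrans e; rewrite /y; ring.
rewrite e n0 x0; ring.
Qed.

(** The divisor of a line is the sum of its three intersections. Let k be the conjugate of the line
    L, so that L k is the product of the X - xi. The colon ideal J of the product by L contains k
    and L^2, hence the polynomial n^2 with n = k - L, as well as the products of two of the X - xi.
    At a simple root the other two factors are nonzero, and at a multiple root n is nonzero, so J is
    the unit ideal. *)
Lemma line_idealM :
  idealM (idealM (point_ideal E (Some (x1, y x1)))
                 (point_ideal E (Some (x2, y x2))))
    (point_ideal E (Some (x3, y x3))) = principal (line m).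
Proof.
pose k : coord_ring E := (wlin E + m, 1).
have lk : pc ('X - x1%:P) * pc ('X - x2%:P) * pc ('X - x3%:P) = line m * k.
  apply: coordP; rewrite !coordE /= ?mulr0 ?mul0r ?subr0 ?addr0.
    by rewrite -hm; ring.
  by ring.
apply: funext => r; apply/propext; split.
  move: r; apply: idealM_sub; first exact: principal_ideal.
  move=> ab c + hc; move: ab; apply: idealM_sub.
    exact/colon_ideal/principal_ideal.
  move=> a b ha hb.
  have [p ->] := point_ideal_gen (line_horner x1) ha.
  have [q ->] := point_ideal_gen (line_horner x2) hb.
  have [s ->] := point_ideal_gen (line_horner x3) hc.
  rewrite !pcM; move: (pc a.2) (pc b.2) (pc c.2) (pc p) (pc q) (pc s) lk.
  move: (pc ('X - x1%:P)) (pc ('X - x2%:P)) (pc ('X - x3%:P)) (line m) k.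
  move=> A B C L K u v w p' q' s' e.
  exists (p' * q' * s' * K + u * ((q' * B + L * v) * (s' * C + L * w))
          + p' * A * (v * (s' * C + L * w)) + p' * A * q' * B * w).
  ring: e.
case=> c ->; set I := idealM _ _.
have [I0 ID IM] : is_ideal I by exact: idealM_ideal.
rewrite mulrC; apply: (IM c).
pose J := fun r => I (r * line m).
have hJ : is_ideal J by exact/colon_ideal/idealM_ideal.
suff: J 1 by rewrite /J mul1r.
have [J0 JD JM] := hJ.
have X1 := point_ideal_X x1 (y x1);
  have L1 := point_ideal_line (line_horner x1).
have X2 := point_ideal_X x2 (y x2);
  have L2 := point_ideal_line (line_horner x2).
have X3 := point_ideal_X x3 (y x3);
  have L3 := point_ideal_line (line_horner x3).
have JT a b c' d : point_ideal E (Some (x1, y x1)) a ->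
    point_ideal E (Some (x2, y x2)) b -> point_ideal E (Some (x3, y x3)) c' ->
    a * b * c' = d * line m -> J d.
  by move=> ha hb hc e; rewrite /J -e; do 2?apply: idealM_mem.
set A := pc ('X - x1%:P) in X1 lk; set B := pc ('X - x2%:P) in X2 lk.
set C := pc ('X - x3%:P) in X3 lk; set L := line m in L1 L2 L3 lk JT.
have JAB : J (A * B) by apply: (JT A B L).
have JAC : J (A * C) by apply: (JT A L C) => //; ring.
have JBC : J (B * C) by apply: (JT L B C) => //; ring.
have JLA : J (A * L) by apply: (JT A L L).
have JLB : J (B * L) by apply: (JT L B L) => //; ring.
have JLL : J (L * L) by apply: (JT L L L).
have Jk : J k by apply: (JT A B C) => //; rewrite lk mulrC.
pose n := m + m + wlin E.
have kn : pc n = k - L by apply: coordP; rewrite !coordE /L /k /= /n; ring.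
have Jnn : J (pc (n * n)).
  rewrite pcM kn; have -> : (k - L) * (k - L) = (k - 2%:R * L) * k + L * L by
    ring.
  by apply: JD => //; apply: JM.
have n_horner x : n.[x] = 2%:R * y x + a1 E * x + a3 E.
  by rewrite /n /wlin /m !hornerE /y /=; ring.
apply: (@split_ideal_unit _ (fun p => J (pc p)) x1 x2 (pc_ideal hJ)).
- by rewrite pcM.
- have [e|e] := eqVneq ((x1 - x2) * (x1 - x3)) 0; last first.
    exists (('X - x2%:P) * ('X - x3%:P)); first by rewrite pcM.
    by rewrite !(hornerM, hornerXsubC).
  exists (n * n); rewrite // hornerM mulf_neq0 ?n_horner //.
  + exact: double_point_slope e _.
  + exact: double_point_slope e _.
- have [e|e] := eqVneq ((x2 - x1) * (x2 - x3)) 0; last first.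
    exists (('X - x1%:P) * ('X - x3%:P)); first by rewrite pcM.
    by rewrite !(hornerM, hornerXsubC).
  exists (n * n); rewrite // hornerM mulf_neq0 ?n_horner //.
  + by apply: double_point_slope e _; ring.
  + by apply: double_point_slope e _; ring.
Qed.

End CollinearPoints.

Let cl := @class_eq (coord_ring E).

Lemma pc_XsubC_neq0 x : pc ('X - x%:P) <> 0.
Proof. by case=> /eqP; rewrite polyXsubC_eq0. Qed.

Lemma class_eq_refl A : cl A A.
Proof. by exists 1, 1; split=> //; apply/eqP; rewrite oner_neq0. Qed.

Lemma class_principal g : g <> 0 -> cl (principal g) (principal 1).
Proof.
move=> g0; exists 1, g; split=> //; first by apply/eqP; rewrite oner_neq0.
by rewrite !principalM mul1r mulr1.
Qed.

Lemma idealM_neg_class P : on_curve E P ->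
  cl (idealM (point_ideal E P) (point_ideal E (neg_point P))) (principal 1).
Proof.
case: P => [[x y]|] hP; last by rewrite /= principalM mulr1;
  exact: class_eq_refl.
by rewrite point_idealM_neg //; apply/class_principal/pc_XsubC_neq0.
Qed.

Lemma add_point_class P Q : on_curve E P -> on_curve E Q ->
  on_curve E (add_point E P Q) /\
  cl (idealM (point_ideal E P) (point_ideal E Q))
     (point_ideal E (add_point E P Q)).
Proof.
case: P Q => [[x1 y1]|] [[x2 y2]|] hP hQ; last first.
- by rewrite /= principalM mulr1; split=> //; exact: class_eq_refl.
- rewrite [add_point _ _ _]/= idealMC idealM1; last exact: point_ideal_ideal.
  by split=> //; exact: class_eq_refl.
- rewrite [add_point _ _ _]/= idealM1; last exact: point_ideal_ideal.
  by split=> //; exact: class_eq_refl.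
rewrite [add_point _ _ _]/=; case: ifPn => [/andP [/eqP ex /eqP ey]|nopp].
  split=> //; have -> : Some (x2, y2) = neg_point (Some (x1, y1)).
    by rewrite /= ex; congr (Some (_, _)); rewrite -[RHS]addr0 -ey; ring.
  exact: idealM_neg_class.
set l := if _ then _ else _; set x3 := _ - x2.
pose nu := y1 - l * x1.
have yE1 : l * x1 + nu = y1 by rewrite /nu; ring.
move: (hP) (hQ) => /eqP eP /eqP eQ.
(* Besides the incidence of Q with the line, this is Vieta's relation for the coefficient of X. The
   coefficient of X^2 is right by the choice of x3, and the constant one because P lies on the
   curve. *)
have [yE2 slope] : l * x2 + nu = y2 /\
    x1 * x2 + (x1 + x2) * x3 = a4 E - 2%:R * l * nu - a1 E * nu - a3 E * l.
  have [ex|nx] := eqVneq x1 x2.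
    move: nopp; rewrite ex eqxx /= => n0.
    have ey : y1 = y2.
      have /eqP : (y1 - y2) * (y1 + y2 + a1 E * x2 + a3 E) = 0.
        transitivity ((y1 ^+ 2 + a1 E * x1 * y1 + a3 E * y1) -
          (y2 ^+ 2 + a1 E * x2 * y2 + a3 E * y2)); first by rewrite ex; ring.
        by rewrite eP eQ ex subrr.
      by rewrite mulf_eq0 (negbTE n0) orbF subr_eq0 => /eqP.
    split; first by rewrite -ex yE1.
    have hl : l * (2%:R * y1 + a1 E * x1 + a3 E)
        = 3%:R * x1 ^+ 2 + 2%:R * a2 E * x1 + a4 E - a1 E * y1.
      rewrite /l ex eqxx mulfVK //; apply: contraNneq n0 => <-.
      by rewrite ey; apply/eqP; ring.
    apply/eqP; rewrite -subr_eq0; apply/eqP.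
    transitivity (l * (2%:R * y1 + a1 E * x1 + a3 E)
       - (3%:R * x1 ^+ 2 + 2%:R * a2 E * x1 + a4 E - a1 E * y1)).
      by rewrite /x3 /nu -ex; ring.
    by rewrite hl subrr.
  have d0 : x2 - x1 != 0 by rewrite subr_eq0 eq_sym.
  have e2 : l * x2 + nu = y2 by rewrite /nu /l (negbTE nx); field.
  split=> //; apply/eqP; rewrite -subr_eq0 -(mulrI_eq0 _ (mulfI d0)); apply/eqP.
  pose p x y := x ^+ 3 + a2 E * x ^+ 2 + a4 E * x + a6 E
                - (y ^+ 2 + a1 E * x * y + a3 E * y).
  transitivity (p x1 (l * x1 + nu) - p x2 (l * x2 + nu)).
    by rewrite /p /x3; ring.
  by rewrite /p yE1 e2 eP eQ !subrr.
pose m : {poly F} := l%:P * 'X + nu%:P.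
have cubic : wcub E - m ^+ 2 - wlin E * m =
    ('X - x1%:P) * ('X - x2%:P) * ('X - x3%:P).
  have h2 : a2 E = l ^+ 2 + a1 E * l - x1 - x2 - x3 by rewrite /x3; ring.
  have h4 : a4 E = x1 * x2 + (x1 + x2) * x3 + 2%:R * l * nu + a1 E * nu + a3 E
    * l.
    by rewrite slope; ring.
  have h6 : a6 E = nu ^+ 2 + a3 E * nu - x1 * x2 * x3.
    transitivity (y1 ^+ 2 + a1 E * x1 * y1 + a3 E * y1
        - (x1 ^+ 3 + a2 E * x1 ^+ 2 + a4 E * x1)); first by rewrite eP; ring.
    by rewrite h4 h2 -yE1; ring.
  rewrite /wcub /wlin /m h6 h4 h2 -!mul_polyC; ring.
have hS : on_curve E (Some (x3, l * x3 + nu)).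
  by apply: (line_on_curve cubic); rewrite subrr mulr0.
set P3 := Some (_, _); have eP3 : P3 = neg_point (Some (x3, l * x3 + nu)).
  by rewrite /P3 /=; congr (Some (_, _)); rewrite -/nu; ring.
split; first by rewrite eP3; apply: neg_on_curve.
(* With S the third intersection and P + Q = -S, the ideal of X - x3 is that of S times that of -S,
   and those of P, Q and S multiply to the ideal of the line. *)
exists (pc ('X - x3%:P)), (line m).
split; [exact: pc_XsubC_neq0|by case=> _ /eqP; rewrite oner_eq0|].
rewrite -(line_idealM cubic) -(point_idealM_neg hS) -eP3 yE1 yE2.
by rewrite idealMC -!idealMA.
Qed.

(** If the classes agree, P + (-Q) has trivial class, so it is no affine point; the addition formula
    yields infinity only when its arguments are opposite. *)
Lemma point_ideal_inj P Q : on_curve E P -> on_curve E Q ->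
  cl (point_ideal E P) (point_ideal E Q) -> P = Q.
Proof.
move=> hP hQ e; have hN := neg_on_curve hQ.
have [hR cR] := add_point_class hP hN.
have {cR} c1 : cl (point_ideal E (add_point E P (neg_point Q))) (principal 1).
  apply: (class_eq_trans (@coord_domain _ E)) (class_eq_sym cR) _.
  apply: (class_eq_trans (@coord_domain _ E)) (class_eqM _ e) _.
  exact: idealM_neg_class.
have : add_point E P (neg_point Q) = None.
  case: (add_point _ _ _) hR c1 => // -[x y] hR c1.
  have [g hg] := class_eq_principal (@coord_domain _ E) (point_ideal_ideal hR)
    c1.
  by case: (point_ideal_not_principal hR hg).
rewrite -[RHS]neg_pointK;
  case: P Q {hP hQ e hN hR c1} => [[x1 y1]|] [[x2 y2]|] //=.
case: ifP => // /andP [/eqP -> /eqP e] _; congr (Some (_, _)).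
by rewrite -[LHS]addr0 -[0]oppr0 -e; ring.
Qed.

Lemma add_point_on_curve P Q : on_curve E P -> on_curve E Q ->
  on_curve E (add_point E P Q).
Proof. by move=> hP hQ; case: (add_point_class hP hQ). Qed.

Lemma add_pointC P Q : on_curve E P -> on_curve E Q ->
  add_point E P Q = add_point E Q P.
Proof.
move=> hP hQ; have [h1 c1] := add_point_class hP hQ.
have [h2 c2] := add_point_class hQ hP.
apply: point_ideal_inj => //; rewrite idealMC in c2.
exact: (class_eq_trans (@coord_domain _ E)) (class_eq_sym c1) c2.
Qed.

Lemma add_pointA P Q R : on_curve E P -> on_curve E Q -> on_curve E R ->
  add_point E P (add_point E Q R) = add_point E (add_point E P Q) R.
Proof.
have tr := class_eq_trans (@coord_domain _ E).
move=> hP hQ hR; have [h1 c1] := add_point_class hP hQ.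
have [h2 c2] := add_point_class hQ hR; have [h3 c3] := add_point_class hP h2.
have [h4 c4] := add_point_class h1 hR; apply: point_ideal_inj => //.
apply: (tr _ _ _ (class_eq_sym c3)); apply: (tr _ _ _ _ c4); rewrite idealMC.
apply: (tr _ _ _ (class_eqM _ (class_eq_sym c2))).
by rewrite idealMC idealMA; apply: class_eqM.
Qed.

Lemma add_neg_point P : add_point E (neg_point P) P = None.
Proof.
case: P => [[x y]|] //=; rewrite eqxx /=; case: eqP => // -[].
by ring.
Qed.

End GroupLaw.

(** * The abelian group of points *)

Record ecurve (F : fieldType) :=
  ECurve { ecurve_eq :> weierstrass F; ecurveP : discriminant ecurve_eq != 0 }.

Record ecgroup (F : fieldType) (E : ecurve F) :=
  ECGroup { ecval :> option (F * F); ecvalP : on_curve E ecval }.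

HB.instance Definition _ (F : fieldType) (E : ecurve F) :=
  [isSub of ecgroup E for @ecval F E].
HB.instance Definition _ (F : fieldType) (E : ecurve F) :=
  [Choice of ecgroup E by <:].

Section PointGroup.
Variables (F : fieldType) (E : ecurve F).

Definition ec_zero : ecgroup E := @ECGroup F E None isT.
Definition ec_opp (P : ecgroup E) : ecgroup E :=
  ECGroup (neg_on_curve (ecvalP P)).
Definition ec_add (P Q : ecgroup E) : ecgroup E :=
  ECGroup (add_point_on_curve (ecurveP E) (ecvalP P) (ecvalP Q)).

Fact ec_addA : associative ec_add.
Proof.
by move=> P Q R; apply/val_inj/add_pointA; exact: ecvalP || exact: ecurveP.
Qed.
Fact ec_addC : commutative ec_add.
Proof.
by move=> P Q; apply/val_inj/add_pointC; exact: ecvalP || exact: ecurveP.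
Qed.
Fact ec_add0 : left_id ec_zero ec_add.
Proof. by move=> P; apply: val_inj. Qed.
Fact ec_addN : left_inverse ec_zero ec_opp ec_add.
Proof. by move=> P; apply: val_inj; exact: add_neg_point. Qed.

HB.instance Definition _ :=
  GRing.isZmodule.Build (ecgroup E) ec_addA ec_addC ec_add0 ec_addN.

Lemma ecvalD (P Q : ecgroup E) : ecval (P + Q) = add_point E P Q.
Proof. by []. Qed.

Lemma ecval_mul n (P : ecgroup E) : ecval (P *+ n) = mul_point E n P.
Proof. by elim: n => // n IHn; rewrite mulrS ecvalD IHn. Qed.

End PointGroup.

(** * 2-adic integers and Tate modules *)

Section Dyadic.
Implicit Types (a b : Z2).

Lemma z2_lt a n : (z2_res a n < 2 ^ n.+1)%N.
Proof. exact: leq_trans (ltn_ord _) (eq_leq (Zp_trunc2 n)). Qed.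

Lemma z2_modP a b : (forall n, z2_res a n = z2_res b n %[mod 2 ^ n.+1]) -> a =
  b.
Proof.
move=> h; apply: Z2_eqP => n; apply: val_inj => /=.
by have := h n; rewrite !modn_small ?z2_lt.
Qed.

Lemma z2_valM a b n :
  z2_res (a * b) n = (z2_res a n * z2_res b n)%N %[mod 2 ^ n.+1].
Proof. by rewrite /= z2_mod1. Qed.

Lemma z2_valD a b n :
  z2_res (a + b) n = (z2_res a n + z2_res b n)%N %[mod 2 ^ n.+1].
Proof. by rewrite /= z2_mod1. Qed.

Lemma z2_val_nat k n : z2_res k%:R n = k %[mod 2 ^ n.+1].
Proof.
elim: k => [|k IHk]; first by rewrite /= mod0n.
by rewrite mulrS z2_valD -modnDmr IHk modnDmr -modnDml (z2_mod1 n 1) modnDml.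
Qed.

Lemma z2_shift a n m : z2_res a (n + m) = z2_res a n %[mod 2 ^ n.+1].
Proof.
elim: m => [|m IHm]; first by rewrite addn0.
rewrite addnS -IHm -(@modn_dvdm (2 ^ (n + m).+1)); last first.
  by rewrite dvdn_exp2l // ltnS leq_addr.
by rewrite z2_coh modn_dvdm // dvdn_exp2l // ltnS leq_addr.
Qed.

Lemma z2_div2 a : ~~ odd (z2_res a 0) -> exists b, a = 2%:R * b.
Proof.
move=> a0; have ev n : ~~ odd (z2_res a n).
  have /(congr1 odd) := z2_shift a 0 n.
  by rewrite add0n !odd_mod ?oddX // => ->.
(* Halving loses one binary digit, so the residue of the quotient at level n comes from level n + 1
   of a. *)
have lth n : ((z2_res a n.+1)./2 < (Zp_trunc (2 ^ n.+1)).+2)%N.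
  apply: leq_trans (eq_leq (esym (Zp_trunc2 n))).
  by have := z2_lt a n.+1; move: (nat_of_ord _) => x; rewrite expnS; lia.
have half n : z2_res a n = (2 * (z2_res a n)./2)%N :> nat by have := ev n; lia.
have coh : coherent (fun n => Ordinal (lth n)).
  move=> n /=; have := z2_coh a n.+1; rewrite (half n.+2) (half n.+1).
  move: (nat_of_ord _) (nat_of_ord _) => x y; rewrite !mul2n !doubleK -!mul2n.
  by rewrite [in (2 ^ _)%N]expnS -!muln_modr => /eqP;
    rewrite eqn_pmul2l // => /eqP.
exists (MkZ2 coh); apply: z2_modP => n.
by rewrite z2_valM -modnMml z2_val_nat modnMml /= -half z2_coh.
Qed.

Lemma z2_parity a : exists b, a = 2%:R * b \/ a = 1 + 2%:R * b.
Proof.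
have [o|e] := boolP (odd (z2_res a 0)); last first.
  by have [b ->] := z2_div2 e; exists b; left.
have [|b hb] := @z2_div2 (a - 1); last by exists b; right;
  rewrite -hb addrC subrK.
have := z2_valD (a - 1) 1 0; rewrite subrK; move: (a - 1) o => b.
have -> : nat_of_ord (z2_res 1 0) = 1%N by [].
by move: (nat_of_ord _) (nat_of_ord _) => x y; rewrite expn1; lia.
Qed.

End Dyadic.

Lemma ord2P (i : 'I_2) : i = 0 \/ i = 1.
Proof. by case: i => [[|[|//]] hi]; [left|right]; apply: val_inj. Qed.

(* [tate] and [comb] are [tate_module] and [tate_comb] for an abstract abelian
   group. *)
Section TateGroup.
Variables (V : zmodType) (e : 'I_2 -> nat -> V).
Implicit Types (t : nat -> V) (a b : Z2) (c d : 'cV[Z2]_2).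

Definition tate t := t 0 = 0 /\ forall n, t n.+1 *+ 2 = t n.
Definition comb c n : V := e 0 n *+ z2_res (c 0 0) n + e 1 n *+ z2_res (c 1 0)
  n.

Lemma tate_torsion t n : tate t -> t n *+ 2 ^ n = 0.
Proof.
by case=> t0 tS; elim: n => [|n IHn]; rewrite ?expnS ?mulrnA ?tS // t0.
Qed.

Lemma tate_shift t n m : tate t -> t (m + n)%N *+ 2 ^ m = t n.
Proof.
case=> t0 tS; elim: m n => [|m IHm] n; first by rewrite expn0 mulr1n.
by rewrite expnSr mulrnA addSnnS IHm tS.
Qed.

Lemma eqmod_mulrn (x : V) (n k l : nat) : x *+ 2 ^ n = 0 ->
  k = l %[mod 2 ^ n] -> x *+ k = x *+ l.
Proof.
move=> x0 e'; rewrite (divn_eq k (2 ^ n)) (divn_eq l (2 ^ n)) e'.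
by rewrite !mulrnDr ![(_ * 2 ^ n)%N]mulnC !(mulrnA _ (2 ^ n)) x0 !mul0rn.
Qed.

(** Bridges the index shift: [z2_res a n] is a residue modulo 2^(n+1) but acts on 2^n-torsion. *)
Lemma eqmod_half n k l : k = l %[mod 2 ^ n.+1] -> k = l %[mod 2 ^ n].
Proof.
by move=> h; rewrite -(@modn_dvdm (2 ^ n.+1) k) ?dvdn_exp2l // h modn_dvdm
  ?dvdn_exp2l.
Qed.

Section Scale.
Variables (x : V) (n : nat).
Hypothesis x0 : x *+ 2 ^ n = 0.

Lemma mulz2D a b : x *+ z2_res (a + b) n = x *+ z2_res a n + x *+ z2_res b n.
Proof.
by rewrite -mulrnDr; apply: (eqmod_mulrn x0); apply/eqmod_half/z2_valD.
Qed.

Lemma mulz2M a b : x *+ z2_res (a * b) n = x *+ z2_res a n *+ z2_res b n.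
Proof.
by rewrite -mulrnA; apply: (eqmod_mulrn x0); apply/eqmod_half/z2_valM.
Qed.

Lemma mulz2_nat k : x *+ z2_res k%:R n = x *+ k.
Proof. by apply: (eqmod_mulrn x0); apply/eqmod_half/z2_val_nat. Qed.

Lemma mulz2_shift a m : x *+ z2_res a (n + m) = x *+ z2_res a n.
Proof. by apply: (eqmod_mulrn x0); apply/eqmod_half/z2_shift. Qed.

End Scale.

Hypothesis he : forall i, tate (e i).

Lemma basis_torsion i n : e i n *+ 2 ^ n = 0.
Proof. exact: tate_torsion. Qed.
Hint Resolve basis_torsion : core.

Lemma combD c d n : comb (c + d) n = comb c n + comb d n.
Proof. by rewrite /comb !mxE !mulz2D // addrACA. Qed.

Lemma combZ a c n : comb (a *: c) n = comb c n *+ z2_res a n.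
Proof. by rewrite /comb !mxE mulrnDl ![a * _]mulrC !mulz2M. Qed.

Lemma combZn k c n : comb (k%:R *: c) n = comb c n *+ k.
Proof.
rewrite combZ mulz2_nat // /comb mulrnDl -!(mulrnAC _ (2 ^ n)) !basis_torsion.
by rewrite !mul0rn addr0.
Qed.

Lemma comb_torsion c n : comb c n *+ 2 ^ n = 0.
Proof.
by rewrite /comb mulrnDl -!(mulrnAC _ (2 ^ n)) !basis_torsion !mul0rn addr0.
Qed.

Lemma comb_delta i n : comb (delta_mx i 0) n = e i n.
Proof.
rewrite /comb !mxE; case: (ord2P i) => -> /=.
  by rewrite (@mulz2_nat _ n _ 1) ?(@mulz2_nat _ n _ 0) // addr0.
by rewrite (@mulz2_nat _ n _ 1) ?(@mulz2_nat _ n _ 0) // add0r.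
Qed.

Lemma comb_shift c n m : comb c (m + n) *+ 2 ^ m = comb c n.
Proof.
rewrite /comb mulrnDl -!(mulrnAC _ (2 ^ m)) !tate_shift // addnC !mulz2_shift
  //.
Qed.

Lemma comb_tate c : tate (comb c).
Proof.
split=> [|n]; first by have := comb_torsion c 0; rewrite expn0 mulr1n.
by have := comb_shift c n 1; rewrite add1n expn1.
Qed.

Hypothesis hb : forall t, tate t -> exists! c, comb c = t.

Lemma comb_inj c d : (forall n, comb c n = comb d n) -> c = d.
Proof.
move=> /funext h; have [x [_ hx]] := hb (comb_tate d).
by rewrite -(hx c h) -(hx d).
Qed.

(* The shifted sequence [comb c (m + n)] lies in the Tate module. *)
Lemma comb_eq0 c n : comb c n = 0 -> exists d, c = (2 ^ n)%:R *: d.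
Proof.
move=> c0; have ct := comb_tate c.
have [|d [hd _]] := @hb (fun m => comb c (m + n)).
  by split=> [|m] //; case: ct => _ h; rewrite addSn h.
exists d; apply: comb_inj => m; rewrite combZn hd.
by rewrite addnC comb_shift.
Qed.

Lemma comb_eq c d n : comb c n = comb d n -> exists x, c = d + (2 ^ n)%:R *: x.
Proof.
move=> h; have [|x hx] := @comb_eq0 (c - d) n; last first.
  by exists x; rewrite -hx addrC subrK.
by apply: (addIr (comb d n)); rewrite -combD subrK add0r.
Qed.

Lemma comb_congr c d x n m : c = d + (2 ^ m)%:R *: x -> (n <= m)%N ->
  comb c n = comb d n.
Proof.
move=> -> le; rewrite combD combZn -(subnKC le) expnD mulrnA comb_torsion.
by rewrite mul0rn addr0.
Qed.

End TateGroup.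

Section Action.
Variables (V : zmodType) (e : 'I_2 -> nat -> V).
Hypothesis he : forall i, tate (e i).
Hypothesis hb : forall t, tate t -> exists! c, comb e c = t.
Implicit Types (f g : V -> V) (M N X : 'M[Z2]_2).

(** The column convention is that of [galois_rep]; with [acts_uniq], this relation replaces
    computations with chosen coordinates. *)
Definition acts f M := forall j n, f (e j n) = comb e (col j M) n.

Lemma acts_ex (f : {additive V -> V}) : exists M, acts f M.
Proof.
have ft j : tate (fun n => f (e j n)).
  by case: (he j) => e0 eS; split=> [|n]; rewrite ?e0 ?raddf0 // -raddfMn eS.
have [c hc] : exists c : 'I_2 -> 'cV[Z2]_2, forall j n, f (e j n) = comb e (c
  j) n.
  have [c0 [h0 _]] := hb (ft 0); have [c1 [h1 _]] := hb (ft 1).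
  exists (fun j => if j == 0 then c0 else c1) => j n.
  by case: (ord2P j) => -> /=; rewrite ?h0 ?h1.
exists (\matrix_(i, j) c j i 0) => j n; rewrite hc; congr (comb e _ n).
by apply/matrixP => i k; rewrite !mxE [k]ord1.
Qed.

Lemma acts_uniq f M N : acts f M -> acts f N -> M = N.
Proof.
move=> hM hN; apply/matrixP => i j.
have /(congr1 (fun c : 'cV_2 => c i 0)) : col j M = col j N.
  by apply: (comb_inj he hb) => n; rewrite -hM hN.
by rewrite !mxE.
Qed.

Lemma comb_acts (f : {additive V -> V}) M c n : acts f M ->
  f (comb e c n) = comb e (M *m c) n.
Proof.
move=> hM; rewrite /comb raddfD !raddfMn /= !hM -!combZ // -combD //.
congr (comb e _ n); apply/matrixP => i j;
  rewrite !mxE !big_ord_recl big_ord0 !ord1.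
rewrite addr0; congr (_ + _); rewrite mulrC //.
by congr (M i _ * c _ _); apply: val_inj.
Qed.

Lemma actsM (f g : {additive V -> V}) M N : acts f M -> acts g N ->
  acts (f \o g) (M *m N).
Proof.
move=> hM hN j n; rewrite /= hN (comb_acts _ _ hM); congr (comb e _ n).
by rewrite !colE mulmxA.
Qed.

Lemma acts1 : acts id 1%:M.
Proof. by move=> j n; rewrite colE mul1mx comb_delta. Qed.

Lemma acts_fix f M n : acts f M -> (forall j, f (e j n) = e j n) ->
  exists X, M = 1%:M + (2 ^ n)%:R *: X.
Proof.
move=> hM hf; have [x hx] : exists x : 'I_2 -> 'cV[Z2]_2,
    forall j, col j M = delta_mx j 0 + (2 ^ n)%:R *: x j.
  have h j : comb e (col j M) n = comb e (delta_mx j 0) n.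
    by rewrite -hM hf comb_delta.
  have [x0 h0] := comb_eq he hb (h 0); have [x1 h1] := comb_eq he hb (h 1).
  by exists (fun j => if j == 0 then x0 else x1) => j; case: (ord2P j) => ->.
exists (\matrix_(i, j) x j i 0); apply/matrixP => i j.
have /(congr1 (fun c : 'cV_2 => c i 0)) := hx j.
by rewrite !mxE eqxx andbT => ->.
Qed.

End Action.

(** * Dense subgroups of V_1(2) *)

Section Density.
Implicit Types (M N X Y B : 'M[Z2]_2).
Variable S : 'M[Z2]_2 -> Prop.
Hypothesis S_mul : forall M N, S M -> S N -> S (M * N).
Hypothesis S_inv : forall M, S M -> exists2 N, S N & M * N = 1.
Hypothesis S_mod4 : forall X, exists2 M, S M & exists Y, M = 1 + 2%:R *: X +
  4%:R *: Y.

(** Describes the image of S in V_2/V_3, which is identified with the 2 by 2 matrices over the field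
    with two elements. The next lemmas make it a linear subspace. *)
Let T X := exists2 M, S M & exists Y, M = 1 + 4%:R *: X + 8%:R *: Y.

Lemma mul_1Z a b X Y : (1 + a *: X) * (1 + b *: Y) =
  1 + a *: X + b *: Y + (a * b) *: (X * Y).
Proof.
by rewrite mulrDl mul1r mulrDr mulr1 -scalerAl -scalerAr scalerA addrACA addrA
  addrAC.
Qed.

Lemma layer2_add X X' : T X -> T X' -> T (X + X').
Proof.
move=> [M SM [Y eM]] [M' SM' [Y' eM']]; exists (M * M'); first exact: S_mul.
have -> : M = 1 + 4%:R *: (X + 2%:R *: Y).
  by rewrite eM; apply/matrixP => i j; rewrite !mxE; ring.
have -> : M' = 1 + 4%:R *: (X' + 2%:R *: Y').
  by rewrite eM'; apply/matrixP => i j; rewrite !mxE; ring.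
rewrite mul_1Z; move: (_ * _ : 'M_2) => Z.
by exists (Y + Y' + 2%:R *: Z); apply/matrixP => i j; rewrite !mxE; ring.
Qed.

Lemma layer2_congr X X' Y : X' = X + 2%:R *: Y -> T X -> T X'.
Proof.
move=> -> [M SM [Z eM]]; exists M => //; exists (Z - Y); rewrite eM.
by apply/matrixP => i j; rewrite !mxE; ring.
Qed.

Lemma layer2_square X : T (X + X * X).
Proof.
have [M SM [Y eM]] := S_mod4 X; exists (M * M); first exact: S_mul.
have -> : M = 1 + 2%:R *: (X + 2%:R *: Y).
  by rewrite eM; apply/matrixP => i j; rewrite !mxE; ring.
rewrite mul_1Z (mulrDl X) !(mulrDr X) !(mulrDr (_ *: Y)).
rewrite -!scalerAl -!scalerAr.
move: (X * X) (X * Y) (Y * X) (Y * Y) => A B C D.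
by exists (Y + B + C + 2%:R *: D); apply/matrixP => i j; rewrite !mxE; ring.
Qed.

Lemma layer2_scale a X : T X -> T (a *: X).
Proof.
move=> TX; have [b [->|->]] := z2_parity a; last first.
  apply: (layer2_congr (X := X) (Y := b *: X)) => //.
  by apply/matrixP => i j; rewrite !mxE; ring.
apply: (layer2_congr (X := X + X) (Y := (b - 1) *: X)); last exact: layer2_add.
by apply/matrixP => i j; rewrite !mxE; ring.
Qed.

Lemma mx2P X Y : X 0 0 = Y 0 0 -> X 0 1 = Y 0 1 -> X 1 0 = Y 1 0 ->
  X 1 1 = Y 1 1 -> X = Y.
Proof.
by move=> *; apply/matrixP => i j; case: (ord2P i) => ->; case: (ord2P j) => ->.
Qed.

Let E00 : 'M[Z2]_2 := delta_mx 0 0.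
Let E01 : 'M[Z2]_2 := delta_mx 0 1.
Let E10 : 'M[Z2]_2 := delta_mx 1 0.
Let E11 : 'M[Z2]_2 := delta_mx 1 1.

(* [X + X * X] mod 2 spans the matrices of even trace, so that one matrix of
   odd trace suffices. *)
Lemma layer2_full B b : T B -> B 0 0 + B 1 1 = 1 + 2%:R * b -> forall X, T X.
Proof.
move=> TB tB.
have T01 : T E01.
  by have := layer2_square E01;
    rewrite -[_ * _]/(_ *m _) mul_delta_mx_0 // addr0.
have T10 : T E10.
  by have := layer2_square E10;
    rewrite -[_ * _]/(_ *m _) mul_delta_mx_0 // addr0.
(* The swap matrix J squares to 1, so J + (J + J^2) is 1 modulo 2. *)
have T1 : T 1.
  pose J := E01 + E10; have TJ := layer2_add T01 T10.
  apply: (layer2_congr (Y := - J)) (layer2_add TJ (layer2_square J)).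
  have -> : J * J = 1.
    by apply: mx2P; rewrite !(mxE, big_ord_recl, big_ord0) /=; ring.
  by apply: mx2P; rewrite !mxE /=; ring.
(* Once the off-diagonal part is cancelled modulo 2, a diagonal (odd, even) leaves [E00]. *)
have even_case B' b' c' : T B' -> B' 0 0 = 1 + 2%:R * b' ->
    B' 1 1 = 2%:R * c' -> T E00.
  move=> TB' e0 e1; pose O := B' 0 1 *: E01 + B' 1 0 *: E10.
  apply: (layer2_congr (X := B' + O) (Y := - (O + b' *: E00 + c' *: E11))).
    by apply: mx2P; rewrite !mxE /= ?e0 ?e1; ring.
  by apply: layer2_add => //; apply: layer2_add; apply: layer2_scale.
have T00 : T E00.
  (* The odd trace makes the diagonal (odd, even) or (even, odd); adding the identity turns the
     second case into the first. *)
  have [c [e1|e1]] := z2_parity (B 1 1).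
    apply: (even_case B (b - c) c) => //.
    by rewrite -[B 0 0](addrK (B 1 1)) tB e1; ring.
  apply: (even_case (B + 1) (b - c) (1 + c)); first exact: layer2_add.
    by rewrite !mxE -[B 0 0](addrK (B 1 1)) tB e1 /=; ring.
  by rewrite !mxE e1 /=; ring.
have T11 : T E11.
  apply: (layer2_congr (X := 1 + E00) (Y := - E00)); last exact: layer2_add.
  by apply: mx2P; rewrite !mxE /=; ring.
move=> X; have -> : X = X 0 0 *: E00 + X 0 1 *: E01 + (X 1 0 *: E10 + X 1 1 *:
  E11).
  by apply: mx2P; rewrite !mxE /=; ring.
by apply: layer2_add; apply: layer2_add; apply: layer2_scale.
Qed.

Hypothesis layer2 : forall X, T X.

Let q n : Z2 := (2 ^ n)%:R.

Lemma qS n : q n.+1 = 2%:R * q n.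
Proof. by rewrite /q expnS natrM. Qed.

(** Squaring 1 + 2^k X gives 1 + 2^(k+1) X up to 2^(2k) X^2, which is negligible modulo 2^(k+2) only
    when k is at least 2. Hence the first two layers are hypotheses and the induction starts at the
    second. *)
Lemma layer_full n X : exists2 M, S M &
  exists Y, M = 1 + q n.+1 *: X + q n.+2 *: Y.
Proof.
case: n X => [|n] X.
  by have [M SM [Y eM]] := S_mod4 X; exists M => //; exists Y.
elim: n X => [|n IHn] X; first exact: layer2.
have [M SM [Y eM]] := IHn X; exists (M * M); first exact: S_mul.
have -> : M = 1 + q n.+2 *: (X + 2%:R *: Y).
  by rewrite eM (qS n.+2); apply/matrixP => i j; rewrite !mxE; ring.
rewrite mul_1Z; move: (_ * _ : 'M_2) => Z.
exists (Y + q n *: Z); apply/matrixP => i j; rewrite !mxE !qS; ring.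
Qed.

(** Successive approximation: an error M = N + q Y is N (1 + q N^-1 Y), and the second factor is
    matched to one more digit by [layer_full]. *)
Lemma density n M X : M = 1 + 2%:R *: X -> exists2 N, S N &
  exists Y, M = N + q n.+1 *: Y.
Proof.
move=> eM; elim: n => [|n [N SN [Y eN]]].
  have [N SN [Y eN]] := S_mod4 X; exists N => //; exists (- (2%:R *: Y)).
  by rewrite eM eN; apply/matrixP => i j; rewrite !mxE /q; ring.
have [N' SN' e1] := S_inv SN.
have [R SR [Z eR]] := layer_full n (N' * Y).
exists (N * R); first exact: S_mul; exists (- (N * Z)).
rewrite eR !mulrDr mulr1 -!scalerAr mulrA e1 mul1r {1}eN scalerN addrK //.
Qed.

End Density.

(** * Halving points *)

Section TwoTorsion.
Variables (F : fieldType) (E : weierstrass F).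
Hypothesis two_neq0 : (2%:R : F) != 0.
Implicit Types (x y u v w : F) (P : ecpoint F).

(* The roots of [4x^3 + b2 x^2 + 2 b4 x + b6], that is of [(2y + a1 x + a3)^2]
   on the curve. *)
Definition split_by u v w : Prop :=
  [/\ a1 E ^+ 2 + 4%:R * a2 E = - (4%:R * (u + v + w)),
      2%:R * a4 E + a1 E * a3 E = 2%:R * (u * v + u * w + v * w)
    & a3 E ^+ 2 + 4%:R * a6 E = - (4%:R * (u * v * w))].

(** Completes the square in y; its vanishing means a vertical tangent, that is, a point of order
    2. *)
Definition vert x y : F := 2%:R * y + a1 E * x + a3 E.

Lemma four_neq0 : (4%:R : F) != 0.
Proof. by rewrite (natrM _ 2 2) mulf_neq0. Qed.

Lemma split_byC12 u v w : split_by u v w -> split_by v u w.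
Proof. by case=> h1 h2 h3; split; rewrite ?h1 ?h2 ?h3; ring. Qed.

Lemma split_byC23 u v w : split_by u v w -> split_by u w v.
Proof. by case=> h1 h2 h3; split; rewrite ?h1 ?h2 ?h3; ring. Qed.

Lemma split_discriminant u v w : split_by u v w ->
  discriminant E = 16%:R * ((u - v) * (u - w) * (v - w)) ^+ 2.
Proof.
case=> h1 h2 h3; apply: (mulfI four_neq0).
pose b2 := a1 E ^+ 2 + 4%:R * a2 E; pose b4 := 2%:R * a4 E + a1 E * a3 E.
pose b6 := a3 E ^+ 2 + 4%:R * a6 E.
(* Uses 4 b8 = b2 b6 - b4^2. *)
transitivity (- b2 ^+ 2 * (b2 * b6 - b4 ^+ 2) - 32%:R * b4 ^+ 3
    - 108%:R * b6 ^+ 2 + 36%:R * b2 * b4 * b6).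
  by rewrite /discriminant /b2 /b4 /b6; ring.
by rewrite /b2 /b4 /b6 h1 h2 h3; ring.
Qed.

Lemma split_coef u v w : split_by u v w ->
  [/\ a2 E = - (u + v + w) - a1 E ^+ 2 / 4%:R,
      a4 E = (u * v + u * w + v * w) - a1 E * a3 E / 2%:R
    & a6 E = - (u * v * w) - a3 E ^+ 2 / 4%:R].
Proof.
have four := four_neq0; case=> h1 h2 h3; split.
- apply: (mulfI four); transitivity (a1 E ^+ 2 + 4%:R * a2 E - a1 E ^+ 2).
    by ring.
  by rewrite h1; field.
- apply: (mulfI two_neq0).
  transitivity (2%:R * a4 E + a1 E * a3 E - a1 E * a3 E); first by ring.
  by rewrite h2; field.
- apply: (mulfI four); transitivity (a3 E ^+ 2 + 4%:R * a6 E - a3 E ^+ 2).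
    by ring.
  by rewrite h3; field.
Qed.

Lemma on_curve_split u v w x y : split_by u v w ->
  on_curve E (Some (x, y)) =
  (vert x y ^+ 2 == 4%:R * ((x - u) * (x - v) * (x - w))).
Proof.
case=> h1 h2 h3; rewrite /on_curve -[LHS]subr_eq0 -[RHS]subr_eq0.
rewrite -[LHS](mulrI_eq0 _ (mulfI four_neq0)); congr (_ == 0).
transitivity (vert x y ^+ 2 - (4%:R * x ^+ 3 + (a1 E ^+ 2 + 4%:R * a2 E) * x
  ^+ 2
  + 2%:R * (2%:R * a4 E + a1 E * a3 E) * x + (a3 E ^+ 2 + 4%:R * a6 E))).
  by rewrite /vert; ring.
by rewrite h1 h2 h3; ring.
Qed.

(** The third root w is read off from the sum of the roots, - b2 / 4. Subtracting the cubic
    equations of u and v and dividing by u - v gives b4, and then either equation gives b6. *)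
Lemma two_torsion_split u v yu yv :
  on_curve E (Some (u, yu)) -> on_curve E (Some (v, yv)) ->
  vert u yu = 0 -> vert v yv = 0 -> u != v ->
  exists w, split_by u v w.
Proof.
have four := four_neq0.
move=> hu hv vu vv uv; pose b2 := a1 E ^+ 2 + 4%:R * a2 E.
pose b4 := 2%:R * a4 E + a1 E * a3 E; pose b6 := a3 E ^+ 2 + 4%:R * a6 E.
have cub x y : on_curve E (Some (x, y)) -> vert x y = 0 ->
    4%:R * x ^+ 3 + b2 * x ^+ 2 + 2%:R * b4 * x + b6 = 0.
  move=> /= /eqP e v0; rewrite -[RHS](expr0n _ 2) -v0.
  transitivity (4%:R * (x ^+ 3 + a2 E * x ^+ 2 + a4 E * x + a6 E)
     + a1 E ^+ 2 * x ^+ 2 + 2%:R * a1 E * a3 E * x + a3 E ^+ 2).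
    by rewrite /b2 /b4 /b6; ring.
  by rewrite -e /vert; ring.
have cu := cub _ _ hu vu; have cv := cub _ _ hv vv.
pose w := - b2 / 4%:R - u - v; exists w.
have e2 : b2 = - (4%:R * (u + v + w)) by rewrite /w; field.
have e4 : b4 = 2%:R * (u * v + u * w + v * w).
  have uv0 : u - v != 0 by rewrite subr_eq0.
  apply: (mulfI two_neq0); apply: (mulfI uv0); apply/eqP; rewrite -subr_eq0.
  apply/eqP; transitivity (4%:R * u ^+ 3 + b2 * u ^+ 2 + 2%:R * b4 * u + b6
    - (4%:R * v ^+ 3 + b2 * v ^+ 2 + 2%:R * b4 * v + b6)).
    by rewrite e2; ring.
  by rewrite cu cv subrr.
split=> //; rewrite -/b6 -[LHS]subr0 -cu e2 e4; ring.
Qed.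

Section Split.
Variables (u v w : F).
Hypothesis hs : split_by u v w.
Hypothesis disc : discriminant E != 0.

Lemma split_neq : [/\ u - v != 0, u - w != 0 & v - w != 0].
Proof.
move: disc; rewrite (split_discriminant hs) mulf_eq0 expf_eq0 /= !mulf_eq0.
by rewrite !negb_or => /andP [_ /andP [/andP [-> ->] ->]].
Qed.

(* The square root of [x(2P) - u]. *)
Definition half_root x y : F := ((x - u) ^+ 2 - (u - v) * (u - w)) / vert x y.

Lemma double_point x y : on_curve E (Some (x, y)) -> vert x y != 0 ->
  exists y', add_point E (Some (x, y)) (Some (x, y)) =
    Some (u + half_root x y ^+ 2, y').
Proof.
move=> hP n0; rewrite /= eqxx.
have -> : (y + y + a1 E * x + a3 E == 0) = false.
  by apply: contraNF n0 => /eqP <-; rewrite /vert; apply/eqP; ring.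
eexists; congr (Some (_, _)) => /=.
have [-> e4 _] := split_coef hs; rewrite {}e4.
have := hP; rewrite (on_curve_split _ _ hs) => /eqP hY.
have four := four_neq0.
set Y := vert x y in hY n0.
have -> : 2%:R * y + a1 E * x + a3 E = Y by [].
have ey : y = (Y - a1 E * x - a3 E) / 2%:R by rewrite /Y /vert; field.
rewrite /half_root -/Y ey.
(* In terms of x and Y the curve is Y^2 = 4 (x - u) (x - v) (x - w), and the duplication formula no
   longer involves [a1] and [a3]. *)
transitivity (((3%:R * x ^+ 2 - 2%:R * (u + v + w) * x + (u * v + u * w + v *
  w)) ^+ 2
   + (u + v + w - 2%:R * x) * Y ^+ 2) / Y ^+ 2).
  by field; rewrite n0 four two_neq0.
transitivity ((((x - u) ^+ 2 - (u - v) * (u - w)) ^+ 2 + u * Y ^+ 2) / Y ^+ 2).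
  by congr (_ / _); rewrite hY; ring.
by field.
Qed.

(** Translation by a point of order 2 acts on abscissas as a Moebius involution exchanging v with
    infinity and u with w. *)
Lemma add_two_torsion x y yv : on_curve E (Some (x, y)) ->
  vert x y != 0 -> vert v yv = 0 ->
  exists y', add_point E (Some (x, y)) (Some (v, yv)) =
      Some (v + (v - u) * (v - w) / (x - v), y') /\
    vert (v + (v - u) * (v - w) / (x - v)) y' =
      - vert x y * ((v - u) * (v - w)) / (x - v) ^+ 2.
Proof.
have four := four_neq0.
move=> hP n0 nv; have := hP; rewrite (on_curve_split _ _ hs) => /eqP hY.
have d0 : x - v != 0.
  apply: contraNneq n0 => xv; rewrite -sqrf_eq0 hY xv; apply/eqP; ring.
have d1 : v - x != 0 by rewrite -oppr_eq0 opprB.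
have nx : (x == v) = false by apply/negbTE; rewrite -subr_eq0.
rewrite /= nx /=; have [ea _ _] := split_coef hs.
set l := (yv - y) / (v - x); set Y := vert x y in hY n0 *.
have el : l = Y / (2%:R * (x - v)) - a1 E / 2%:R.
  have ey : y = (Y - a1 E * x - a3 E) / 2%:R by rewrite /Y /vert; field.
  have eyv : yv = (0 - a1 E * v - a3 E) / 2%:R by rewrite -nv /vert; field.
  by rewrite /l ey eyv; field; rewrite d0 d1 two_neq0.
have ex : l ^+ 2 + a1 E * l - a2 E - x - v = v + (v - u) * (v - w) / (x - v).
  transitivity (Y ^+ 2 / (4%:R * (x - v) ^+ 2) + u + w - x).
    by rewrite el ea; field; rewrite d0 four two_neq0.
  by rewrite hY; field; rewrite d0 four.
eexists; split; first by rewrite ex.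
set x3 := v + _.
transitivity (- Y - 2%:R * (l + a1 E / 2%:R) * (x3 - x)).
  by rewrite /Y /vert; field.
have -> : l + a1 E / 2%:R = Y / (2%:R * (x - v)) by rewrite el; ring.
by rewrite /x3; field; rewrite d0 two_neq0.
Qed.

End Split.

Section Translation.
Variables (u v w : F).
Hypothesis hs : split_by u v w.
Hypothesis disc : discriminant E != 0.

Lemma half_root_addv x y yv : on_curve E (Some (x, y)) ->
  vert x y != 0 -> vert v yv = 0 ->
  exists x' y', [/\ add_point E (Some (x, y)) (Some (v, yv)) = Some (x', y'),
    vert x' y' != 0 & half_root u v w x' y' = - half_root u v w x y].
Proof.
move=> hP n0 nv; have [uv uw vw] := split_neq hs disc.
have [y' [e1 e2]] := add_two_torsion hs hP n0 nv.
have vu : v - u != 0 by rewrite -oppr_eq0 opprB.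
have hY := hP; rewrite (on_curve_split _ _ hs) in hY; move/eqP in hY.
have d0 : x - v != 0.
  apply: contraNneq n0 => xv; rewrite -sqrf_eq0 hY xv; apply/eqP; ring.
exists (v + (v - u) * (v - w) / (x - v)), y'; split=> //.
  by rewrite e2 !mulf_neq0 ?invr_eq0 ?expf_neq0 ?oppr_eq0.
rewrite /half_root e2; field.
by rewrite oppr_eq0 n0 d0 vu vw.
Qed.

Lemma half_root_addu x y yu : on_curve E (Some (x, y)) ->
  vert x y != 0 -> vert u yu = 0 ->
  exists x' y', [/\ add_point E (Some (x, y)) (Some (u, yu)) = Some (x', y'),
    vert x' y' != 0 & half_root u v w x' y' = half_root u v w x y].
Proof.
move=> hP n0 nu; have [uv uw vw] := split_neq hs disc.
have [y' [e1 e2]] := add_two_torsion (split_byC12 hs) hP n0 nu.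
have hY := hP; rewrite (on_curve_split _ _ hs) in hY; move/eqP in hY.
have d0 : x - u != 0.
  apply: contraNneq n0 => xv; rewrite -sqrf_eq0 hY xv; apply/eqP; ring.
exists (u + (u - v) * (u - w) / (x - u)), y'; split=> //.
  by rewrite e2 !mulf_neq0 ?invr_eq0 ?expf_neq0 ?oppr_eq0.
by rewrite /half_root e2; field; rewrite oppr_eq0 n0 d0 uv uw.
Qed.

End Translation.

End TwoTorsion.

(** * Reduction modulo the prime *)

Lemma map_discriminant (R S : comNzRingType) (f : {rmorphism R -> S})
    (E : weierstrass R) :
  discriminant (map_weierstrass f E) = f (discriminant E).
Proof.
by rewrite /discriminant /=; ring.
Qed.

Section MapSplit.
Variables (F L : fieldType) (j : {rmorphism F -> L}) (E : weierstrass F).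

Lemma map_split u v w : split_by E u v w ->
  split_by (map_weierstrass j E) (j u) (j v) (j w).
Proof.
case=> /(congr1 j) h1 /(congr1 j) h2 /(congr1 j) h3.
split.
- transitivity (j (a1 E ^+ 2 + 4%:R * a2 E)); first by rewrite /=; ring.
  by rewrite h1; ring.
- transitivity (j (2%:R * a4 E + a1 E * a3 E)); first by rewrite /=; ring.
  by rewrite h2; ring.
- transitivity (j (a3 E ^+ 2 + 4%:R * a6 E)); first by rewrite /=; ring.
  by rewrite h3; ring.
Qed.

Lemma map_vert x y : vert (map_weierstrass j E) (j x) (j y) = j (vert E x y).
Proof. by rewrite /vert /=; ring. Qed.

End MapSplit.

Lemma closed_sqrt (L : closedFieldType) (c : L) : exists x, x ^+ 2 = c.
Proof.
have [x hx] := @solve_monicpoly L 2 (fun i => if i == 0 then c else 0) isT.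
by exists x; rewrite hx !big_ord_recl big_ord0 /= mulr1 mul0r !addr0.
Qed.

Section FullFourTorsion.
Variables (k : finFieldType) (E : weierstrass k).
Hypothesis two_neq0 : (2%:R : k) != 0.
Hypothesis disc : discriminant E != 0.
Hypothesis full4 : full_torsion E 4.

(** The condition on x makes [half_root] vanish, so the double of the point has abscissa u and order
    2. *)
Lemma mul_point4 (F : fieldType) (W : weierstrass F) u v w x y :
    (2%:R : F) != 0 -> discriminant W != 0 -> split_by W u v w ->
    on_curve W (Some (x, y)) -> vert W x y != 0 ->
    (x - u) ^+ 2 = (u - v) * (u - w) ->
  mul_point W 4 (Some (x, y)) = None.
Proof.
move=> two0 d hs hP n0 hx.
have [y' e] := double_point two0 hs hP n0.
rewrite /half_root hx subrr mul0r expr0n addr0 /= in e.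
pose P := @ECGroup F (ECurve d) _ hP.
have P2 : ecval (P *+ 2) = Some (u, y').
  by rewrite mulr2n ecvalD [RHS]/= -e.
have v0 : vert W u y' = 0.
  have := ecvalP (P *+ 2); rewrite P2 (on_curve_split two0 _ _ hs) subrr !mul0r.
  by rewrite mulr0 expf_eq0 => /eqP.
rewrite -[Some _]/(ecval P) -(ecval_mul 4 P) (mulrnA P 2 2) mulr2n ecvalD P2 /=.
rewrite eqxx /=; case: eqP => // -[]; rewrite -v0 /vert; ring.
Qed.

(** With al^2 = u - v and be^2 = u - w, the point with x - u = al be and [vert] equal to 2 al be (al
    + be) has order 4. Being rational, it makes al be and al + be rational, hence also al. *)
Lemma full4_square u v w : split_by E u v w ->
  exists a, u - v = a ^+ 2.
Proof.
move=> hs; have [uv uw vw] := split_neq two_neq0 hs disc.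
have [L [j jint]] := countable_algebraic_closure k.
have [al hal] := closed_sqrt (j (u - v));
  have [be hbe] := closed_sqrt (j (u - w)).
pose W := map_weierstrass j E.
have twoL : (2%:R : L) != 0 by rewrite -(rmorph_nat j) fmorph_eq0.
have dW : discriminant W != 0 by rewrite map_discriminant fmorph_eq0.
have hW : split_by W (j u) (j v) (j w) := map_split j hs.
have al0 : al != 0 by rewrite -sqrf_eq0 hal fmorph_eq0.
have be0 : be != 0 by rewrite -sqrf_eq0 hbe fmorph_eq0.
have ab0 : al + be != 0.
  apply: contraNneq vw => ab; rewrite -(fmorph_eq0 j); apply/eqP.
  transitivity (be ^+ 2 - al ^+ 2); first by rewrite hal hbe !rmorphB; ring.
  by rewrite subr_sqr -opprB [be + al]addrC ab mulr0.
pose x := j u + al * be.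
pose Y := 2%:R * (al * be) * (al + be).
pose y := (Y - a1 W * x - a3 W) / 2%:R.
have yY : vert W x y = Y by rewrite /vert /y; field.
have uvE : j v = j u - al ^+ 2 by rewrite hal rmorphB; ring.
have uwE : j w = j u - be ^+ 2 by rewrite hbe rmorphB; ring.
have hP : on_curve W (Some (x, y)).
  by rewrite (on_curve_split twoL _ _ hW) yY uvE uwE /x /Y; apply/eqP; ring.
have Y0 : vert W x y != 0 by rewrite yY !mulf_neq0.
have [|[[x0 y0]|] hQ //] := full4 jint (P := Some (x, y)).
  split=> //; apply: (mul_point4 twoL dW hW hP Y0).
  by rewrite uvE uwE /x; ring.
case=> ex ey.
have p0 : j (x0 - u) = al * be by rewrite rmorphB ex /x; ring.
have s0 : j (vert E x0 y0) = Y by rewrite -map_vert ex ey.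
have p0' : x0 - u != 0 by rewrite -(fmorph_eq0 j) p0 mulf_neq0.
(* This is (al^2 + al be) / (al + be) = al. *)
exists ((u - v + (x0 - u)) * (2%:R * (x0 - u)) / vert E x0 y0).
apply: (fmorph_inj j); rewrite -hal rmorphXn fmorph_div s0 !rmorphM rmorphD p0.
rewrite -hal rmorph_nat /Y; congr (_ ^+ 2); field.
by rewrite al0 be0 ab0 twoL.
Qed.

(* [2i = (1 + i)^2], so both signs of 2 yield a primitive 8th root of unity. *)
Lemma two_not_square : (#|k| = 5 %[mod 8])%N -> (exists i : k, -1 = i ^+ 2) ->
  forall t z : k, z != 0 -> t ^+ 2 <> 2%:R * z ^+ 2 /\ t ^+ 2 <> - 2%:R * z ^+
    2.
Proof.
move=> h5 [i hi].
have no8 (x : k) : x ^+ 4 <> -1.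
  move=> x4; have [q hq] : exists q, #|k| = (8 * q + 5)%N.
    by exists (#|k| %/ 8)%N; rewrite {1}(divn_eq #|k| 8) h5 mulnC.
  (* Since x^8 = 1, raising to the power #|k| gives x = x^5 = - x, so x = 0. *)
  have := expf_card x; rewrite hq exprD exprM (exprM x 4 2) x4 sqrrN expr1n.
  rewrite expr1n mul1r (exprS x 4) x4 mulrN1 => /eqP.
  rewrite eq_sym -subr_eq0 opprK -mulr2n -mulr_natl mulf_eq0 (negbTE two_neq0)
    /=.
  move=> /eqP x0; move: x4; rewrite x0 expr0n /= => /eqP.
  by rewrite eq_sym oppr_eq0 oner_eq0.
have no2 (t z : k) : z != 0 -> t ^+ 2 <> 2%:R * z ^+ 2.
  move=> z0 e; have t0 : t != 0.
    by rewrite -sqrf_eq0 e mulf_neq0 ?expf_neq0.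
  apply: (no8 ((1 + i) * z / t)); rewrite (exprM _ 2 2) [RHS]hi; congr (_ ^+ 2).
  transitivity ((1 + 2%:R * i + i ^+ 2) * z ^+ 2 / t ^+ 2); first by field.
  by rewrite -hi e; field; rewrite z0 two_neq0.
move=> t z z0; split; first exact: no2.
move=> e; apply: (no2 (i * t) z z0); rewrite exprMn -hi e; ring.
Qed.

End FullFourTorsion.

(** The transformed b2, b4 and b6 depend only on the scaling c and the shift r; the parameters s and
    t drop out. *)
Lemma iso_split (F : fieldType) (E W : weierstrass F) u v w :
  split_by E u v w -> weierstrass_iso E W ->
  exists c r, c != 0 /\
    split_by W ((u - r) / c ^+ 2) ((v - r) / c ^+ 2) ((w - r) / c ^+ 2).
Proof.
case=> h1 h2 h3 [c [r [s [t [c0 [e1 e2 e3 e4 e6]]]]]]; exists c, r; split=> //.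
split.
- apply: (mulfI (expf_neq0 2 c0)).
  transitivity ((c * a1 W) ^+ 2 + 4%:R * (c ^+ 2 * a2 W)); first by ring.
  transitivity (a1 E ^+ 2 + 4%:R * a2 E + 12%:R * r); first by rewrite e1 e2;
    ring.
  by rewrite h1; field.
- apply: (mulfI (expf_neq0 4 c0)).
  transitivity (2%:R * (c ^+ 4 * a4 W) + (c * a1 W) * (c ^+ 3 * a3 W));
    first by ring.
  transitivity (2%:R * a4 E + a1 E * a3 E + r * (a1 E ^+ 2 + 4%:R * a2 E)
     + 6%:R * r ^+ 2); first by rewrite e1 e3 e4; ring.
  by rewrite h1 h2; field.
- apply: (mulfI (expf_neq0 6 c0)).
  transitivity ((c ^+ 3 * a3 W) ^+ 2 + 4%:R * (c ^+ 6 * a6 W)); first by ring.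
  transitivity (a3 E ^+ 2 + 4%:R * a6 E + 2%:R * r * (2%:R * a4 E + a1 E * a3 E)
     + r ^+ 2 * (a1 E ^+ 2 + 4%:R * a2 E) + 4%:R * r ^+ 3).
    by rewrite e3 e6; ring.
  by rewrite h1 h2 h3; field.
Qed.

Lemma integer_cubic (K : fieldExtType rat) (b c d : ring_of_integers K) (x :
  K) :
  x ^+ 3 + val b * x ^+ 2 + val c * x + val d = 0 ->
  exists y : ring_of_integers K, val y = x.
Proof.
move=> e; suff hx : x \in integer_pred K by exists (MkInteger hx).
apply/integer_predP.
pose p : {poly K} := 'X^3 + (val b *: 'X^2 + val c *: 'X + (val d)%:P).
apply: (@integral_root_monic _ _ _ x p).
- rewrite monicE lead_coefDl ?lead_coefXn // size_polyXn ltnS.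
  rewrite (leq_trans (size_polyD _ _)) // geq_max; apply/andP; split.
    rewrite (leq_trans (size_polyD _ _)) // geq_max.
    by rewrite !(leq_trans (size_scale_leq _ _)) ?size_polyX ?size_polyXn.
  by rewrite (leq_trans (size_polyC_leq1 _)).
- by rewrite /root; apply/eqP; apply: etrans e; rewrite /p !hornerE /=; ring.
- have ival (z : ring_of_integers K) := integer_predP _ (valP z).
  apply/integral_poly => i; rewrite /p !(coefD, coefZ, coefXn, coefX, coefC).
  do 3?apply: integral_add; rewrite ?mulr_natr; try by case: eqP => _;
   rewrite ?mulr1n ?mulr0n; exact: integral0 || exact: integral1 || exact: ival.
Qed.

(** Passing to the integral model W and multiplying by squares moves a putative square root into the
    ring of integers. Its reduction would be a square root of 2 or -2 times a nonzero square,
    against [two_not_square]. *)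
Lemma two_not_square_multiple (K : fieldExtType rat) (E : weierstrass K)
    (u v w : K) (hs : split_by E u v w)
    (hp : exists (p : {pred ring_of_integers K})
            (k : finFieldType) (red : {rmorphism ring_of_integers K -> k})
            (W : weierstrass (ring_of_integers K)),
       [/\ nonzero_prime p /\ residue_map p red,
           weierstrass_iso E (map_weierstrass (@integer_val K) W),
           2%:R * discriminant W \notin p,
           #|k| = 5 %[mod 8]
         & full_torsion (map_weierstrass red W) 4])
    (s : bool) (n1 n2 n3 : nat) (x : K) :
  x ^+ 2 <> (-1) ^+ s * 2%:R * ((u - v) ^+ n1 * (u - w) ^+ n2 * (v - w) ^+ n3).
Proof.
move=> hx; case: hp => p [k [red [W [[_ [_ redp]] iso ndisc h5 full4]]]].
have [c [r [c0 hsW]]] := iso_split hs iso.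
set u' := (u - r) / _ in hsW; set v' := (v - r) / _ in hsW.
set w' := (w - r) / _ in hsW.
have [b2 hb2] : exists b, b = a1 W ^+ 2 + 4%:R * a2 W by eexists.
have [b4 hb4] : exists b, b = 2%:R * a4 W + a1 W * a3 W by eexists.
have [b6 hb6] : exists b, b = a3 W ^+ 2 + 4%:R * a6 W by eexists.
have [h1 h2 h3] := hsW.
have v2 : val b2 = - (4%:R * (u' + v' + w')) by rewrite -h1 hb2 /=; ring.
have v4 : val b4 = 2%:R * (u' * v' + u' * w' + v' * w').
  by rewrite -h2 hb4 /=; ring.
have v6 : val b6 = - (4%:R * (u' * v' * w')) by rewrite -h3 hb6 /=; ring.
(* The roots themselves need not be integral, but 4 z is a root of the monic X^3 + b2 X^2 + 8 b4 X +
   16 b6. *)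
have root_int z : (z - u') * (z - v') * (z - w') = 0 ->
    exists y : ring_of_integers K, val y = 4%:R * z.
  move=> z0; apply: (@integer_cubic K b2 (8%:R * b4) (16%:R * b6)).
  transitivity (64%:R * ((z - u') * (z - v') * (z - w')));
    last by rewrite z0 mulr0.
  by rewrite !rmorphM !rmorph_nat /= in v2 v4 v6 *; rewrite v2 v4 v6; ring.
have [|U eU] := root_int u'; first by ring.
have [|V eV] := root_int v'; first by ring.
have [|Z eZ] := root_int w'; first by ring.
have k1 : b2 = - (U + V + Z).
  by apply: val_inj; rewrite rmorphN !rmorphD /= v2 eU eV eZ; ring.
have k2 : 8%:R * b4 = U * V + U * Z + V * Z.
  by apply: val_inj; rewrite !rmorphD !rmorphM rmorph_nat /= v4 eU eV eZ; ring.
have k3 : 16%:R * b6 = - (U * V * Z).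
  by apply: val_inj; rewrite rmorphN !rmorphM rmorph_nat /= v6 eU eV eZ; ring.
have : red (2%:R * discriminant W) != 0 by rewrite redp.
rewrite rmorphM rmorph_nat mulf_eq0 negb_or -map_discriminant => /andP [two
  disc].
have four := four_neq0 two.
set Wk := map_weierstrass red W in full4 disc.
have hk : split_by Wk (red U / 4%:R) (red V / 4%:R) (red Z / 4%:R).
  split.
  - transitivity (red b2); first by rewrite hb2 /=; ring.
    by rewrite k1; field.
  - apply: (mulfI four); apply: (mulfI two).
    transitivity (red (8%:R * b4)); first by rewrite hb4 /=; ring.
    by rewrite k2; field.
  - apply: (mulfI four); apply: (mulfI four).
    transitivity (red (16%:R * b6)); first by rewrite hb6 /=; ring.
    by rewrite k3; field.
have [uv uw vw] := split_neq two hk disc.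
have [a ea] := full4_square two disc full4 hk.
have [b eb] := full4_square two disc full4 (split_byC23 hk).
have [d ed] := full4_square two disc full4 (split_byC23 (split_byC12 hk)).
have [a' ea'] := full4_square two disc full4 (split_byC12 hk).
have a0 : a != 0 by rewrite -sqrf_eq0 -ea.
have b0 : b != 0 by rewrite -sqrf_eq0 -eb.
have d0 : d != 0 by rewrite -sqrf_eq0 -ed.
(* Full 4-torsion makes a difference of two roots and its opposite both squares. *)
have neg1 : exists i : k, -1 = i ^+ 2.
  exists (a' / a); rewrite expr_div_n -ea' -ea; field.
  by move: uv; rewrite -mulrBl mulf_eq0 negb_or four => /andP [-> _].
pose D := (-1) ^+ s * 2%:R * ((U - V) ^+ n1 * (U - Z) ^+ n2 * (V - Z) ^+ n3).
(* Each difference of roots is multiplied by (2/c)^2 on passing from u, v, w to U, V, Z. *)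
pose x' := x * (2%:R / c) ^+ (n1 + n2 + n3).
have ex' : x' ^+ 2 = val D.
  rewrite /x' exprMn hx exprAC !exprD /D.
  rewrite !rmorphM !rmorphXn !rmorphB rmorphN1 rmorph_nat /= eU eV eZ.
  have scale z t : (2%:R / c) ^+ 2 * (z - t) =
      4%:R * ((z - r) / c ^+ 2) - 4%:R * ((t - r) / c ^+ 2) by field.
  by rewrite -!scale !exprMn; ring.
have eN : val (- D) = - x' ^+ 2 by rewrite ex'; exact: rmorphN.
have e0 : val (0 : ring_of_integers K) = 0 by exact: rmorph0.
(* A square root of D is a root of the cubic X^3 - D X. *)
have [|y ey] := @integer_cubic K 0 (- D) 0 x'; first by rewrite eN e0; ring.
have eyD : y ^+ 2 = D by apply: val_inj; rewrite rmorphXn /= ey.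
have := two_not_square two h5 neg1 (red y)
  (z := (2%:R * a) ^+ n1 * (2%:R * b) ^+ n2 * (2%:R * d) ^+ n3).
case; first by rewrite !mulf_neq0 ?expf_neq0 ?mulf_neq0.
have ered : red y ^+ 2 = (-1) ^+ s * 2%:R *
    ((2%:R * a) ^+ n1 * (2%:R * b) ^+ n2 * (2%:R * d) ^+ n3) ^+ 2.
  have sUV : red U - red V = (2%:R * a) ^+ 2 by rewrite exprMn -ea; field.
  have sUZ : red U - red Z = (2%:R * b) ^+ 2 by rewrite exprMn -eb; field.
  have sVZ : red V - red Z = (2%:R * d) ^+ 2 by rewrite exprMn -ed; field.
  rewrite -rmorphXn eyD /D !rmorphM !rmorphXn !rmorphB rmorphN1 rmorph_nat.
  rewrite sUV sUZ sVZ; move: (2%:R * a) (2%:R * b) (2%:R * d) => A B C.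
  by rewrite !exprMn.
by rewrite ered; case: (s) => /= h h'; [apply: h'|apply: h];
  rewrite ?expr0 ?expr1 ?mul1r ?mulN1r.
Qed.

(** * Automorphisms of algC *)

Lemma polyOver_line_rat (L : fieldExtType rat) (p : {poly L}) :
  p \is a polyOver 1%VS -> exists q : {poly rat}, p = map_poly ratr q.
Proof.
move/polyOver1P => [q ->]; exists q; apply: eq_map_poly => a.
by rewrite /= alg_num_field.
Qed.

Lemma rat_poly_map (R S : fieldType) (f : {rmorphism R -> S}) (p : {poly rat})
  x :
  f (map_poly ratr p).[x] = (map_poly ratr p).[f x].
Proof.
rewrite -horner_map -map_poly_comp; congr _.[_].
by apply: eq_map_poly => a /=; rewrite fmorph_rat.
Qed.

(** The primitive element found in [algC] for the image of a basis is a combination of that image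
    with natural coefficients, so it comes from K. *)
Lemma number_field_generator (K : fieldExtType rat) (iota : {rmorphism K ->
  algC}) :
  exists th : K, forall y : K, exists p : {poly rat},
    iota y = (map_poly ratr p).[iota th].
Proof.
pose b := vbasis {:K}.
have [z [a Dz] [ps Ds]] := algC_PET (map iota b).
have sz : size ps = size b by rewrite -(size_map (fun p => (map_poly ratr
  p).[z]) ps) -Ds size_map.
exists (\sum_(i < size (map iota b)) b`_i *+ a i) => y.
have -> : iota (\sum_(i < size (map iota b)) b`_i *+ a i) = z.
  rewrite Dz rmorph_sum; apply: eq_bigr => i _.
  rewrite rmorphMn /= (nth_map 0) //.
  by have := ltn_ord i; rewrite [X in (_ < X)%N]size_map.
exists (\sum_(i < \dim {:K}) coord b i y *: ps`_i).
rewrite rmorph_sum horner_sum {1}(coord_vbasis (memvf y)) rmorph_sum.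
apply: eq_bigr => i _; rewrite /= rmorphZ_num map_polyZ hornerZ; congr (_ * _).
have ib : (i < size b)%N by rewrite size_tuple.
have := congr1 (nth 0 ^~ i) Ds; rewrite (nth_map 0) // => ->.
by rewrite (nth_map 0) // sz.
Qed.

(** A generator of K and x lie in the splitting field of the product of their minimal polynomials.
    Every automorphism of that field over K extends to [algC], so finite Galois theory places x in
    K. *)
Lemma galois_fixed (K : fieldExtType rat) (iota : {rmorphism K -> algC}) x :
  (forall s, abs_galois iota s -> s x = x) -> exists y, iota y = x.
Proof.
move=> fixx; have [th genK] := number_field_generator iota.
pose z := iota th.
have [pz [_ mpz] /(_ pz) rz] := minCpolyP z; rewrite dvdpp in rz.
have [px [_ mpx] /(_ px) rx] := minCpolyP x; rewrite dvdpp in rx.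
pose P := pz * px.
have [r Dr] := closed_field_poly_normal (map_poly ratr P : {poly algC}).
have mP : P \is monic by rewrite monicMl.
rewrite lead_coef_map (monicP mP) rmorph1 scale1r in Dr.
have [Qr [QrC [rr Drr genQr]]] := num_field_exists r.
have inr y : root (map_poly ratr P) y -> exists yy, QrC yy = y.
  rewrite Dr root_prod_XsubC -Drr => /mapP [yy _ ->]; by exists yy.
have [th1 eth] : exists yy, QrC yy = z.
  by apply: inr; rewrite rmorphM rootM rz.
have [x1 ex] : exists yy, QrC yy = x.
  by apply: inr; rewrite rmorphM rootM rx orbT.
have split : splitting_field_axiom Qr.
  exists (map_poly (in_alg Qr) P); first exact: alg_polyOver.
  exists rr => //; congr (_ %= _): (eqpxx (map_poly (in_alg Qr) P)).
  apply/(map_poly_inj QrC); rewrite -map_poly_comp rmorph_prod /=.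
  transitivity (map_poly (ratr : rat -> algC) P).
    by apply: eq_map_poly => a /=; rewrite rmorphZ_num rmorph1 mulr1.
  rewrite Dr -Drr big_map; apply: eq_bigr => y _; by rewrite map_polyXsubC.
pose splitM := FieldExt_isSplittingField.Build _ Qr split.
pose L : splittingFieldType rat := HB.pack Qr splitM.
pose K1 : {subfield L} := <<1; (th1 : L)>>%AS.
have gal : galois K1 {:L}.
  apply/and3P; split; [exact: subvf| |exact: normalFieldf].
  apply/separableP => y _; apply: pcharf0_separable.
  by move=> q; rewrite (fmorph_pchar (in_alg L)) Num.Theory.pchar_num.
have : (x1 : L) \in fixedField 'Gal({:L} / K1)%g.
  apply/fixedFieldP; first exact: memvf.
  move=> g hg; have [nu Dnu] := @extend_algC_subfield_aut L QrC (gal_repr g).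
  have nuz : nu z = z.
    rewrite -eth -Dnu; congr (QrC _); apply: (fixed_gal (subvf _) hg).
    exact: memv_adjoin.
  have gnu : abs_galois iota nu.
    split=> [|y]; last by have [q ->] := genK y; rewrite rat_poly_map -/z nuz.
    exists (algC_invaut nu); last exact: algC_invautK.
    by move=> y; apply: (fmorph_inj nu); rewrite algC_invautK.
  by apply: (fmorph_inj QrC); rewrite Dnu ex (fixx _ gnu).
rewrite (galois_fixedField gal) => /Fadjoin_polyP [p /polyOver_line_rat [q ->]
  e].
exists (map_poly ratr q).[th]; rewrite rat_poly_map -/z -eth -ex e.
exact/esym/rat_poly_map.
Qed.

Section AbsoluteGalois.
Variables (K : fieldExtType rat) (iota : {rmorphism K -> algC}).
Implicit Types s t : {rmorphism algC -> algC}.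

Lemma abs_galoisP s : (forall x, s (iota x) = iota x) -> abs_galois iota s.
Proof.
move=> h; split=> //; exists (algC_invaut s); last exact: algC_invautK.
by move=> y; apply: (fmorph_inj s); rewrite algC_invautK.
Qed.

Lemma abs_galois_comp s t : abs_galois iota s -> abs_galois iota t ->
  abs_galois iota (s \o t).
Proof. by move=> [_ hs] [_ ht]; apply: abs_galoisP => x /=; rewrite ht hs. Qed.

Lemma abs_galois_inv s : abs_galois iota s ->
  abs_galois iota (algC_invaut s).
Proof.
move=> [_ hs]; apply: abs_galoisP => x.
by apply: (fmorph_inj s); rewrite algC_invautK hs.
Qed.

End AbsoluteGalois.

(* Peeling off the head [a] of [l]: on the stabiliser of [a] the claim holds for
   the tail, and if the resulting product is not fixed by all of [H] then its
   character is that of [a]. *)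
Lemma sign_character (H : {rmorphism algC -> algC} -> Prop) (l : seq algC) b :
    (forall s t, H s -> H t -> H (s \o t)) ->
    (forall a s, a \in l -> H s -> s a = a \/ s a = - a) ->
    (forall s, H s -> s b = b \/ s b = - b) ->
    (forall s, H s -> (forall a, a \in l -> s a = a) -> s b = b) ->
  exists n : nat -> nat,
    forall s, H s -> s (b * \prod_(i < size l) l`_i ^+ n i) =
                     b * \prod_(i < size l) l`_i ^+ n i.
Proof.
elim: l H => [|a l IHl] H Hcomp Hl Hb Hfix.
  by exists (fun=> 0) => s Hs; rewrite big_ord0 mulr1 Hfix.
pose H' s := H s /\ s a = a.
have [||||n hn] := IHl H'.
- by move=> s t [Hs sa] [Ht ta]; split; [exact: Hcomp|rewrite /= ta sa].
- by move=> c s lc [Hs _]; apply: Hl; rewrite // inE lc orbT.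
- by move=> s [Hs _]; exact: Hb.
- move=> s [Hs sa] sl; apply: Hfix => // c; rewrite inE => /predU1P [->|] //.
  exact: sl.
set g := b * _ in hn.
have sg s : H s -> s g = g \/ s g = - g.
  move=> Hs; rewrite /g.
  have : s (\prod_(i < size l) l`_i ^+ n i) = \prod_(i < size l) l`_i ^+ n i
      \/ s (\prod_(i < size l) l`_i ^+ n i) = - \prod_(i < size l) l`_i ^+ n i.
    apply: (big_ind (fun y => s y = y \/ s y = - y)).
    - by left; rewrite rmorph1.
    - by move=> y z; rewrite rmorphM => -[->|->] [->|->];
        rewrite ?mulrN ?mulNr ?opprK; [left|right|right|left].
    - move=> i _; rewrite rmorphXn.
      have [|->|->] := Hl l`_i s _ Hs; first by rewrite inE mem_nth ?orbT.
        by left.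
      by rewrite exprNn -signr_odd; case: odd;
        rewrite ?expr0 ?expr1 ?mul1r ?mulN1r; [right|left].
  move: (\prod_(i < size l) _) => y; rewrite rmorphM.
  by case: (Hb _ Hs) => ->; case=> ->; rewrite ?mulrN ?mulNr ?opprK;
    [left|right|right|left].
pose n' m i := if i is j.+1 then n j else m.
have prodE m : b * \prod_(i < size (a :: l)) (a :: l)`_i ^+ n' m i = a ^+ m * g.
  by rewrite big_ord_recl mulrCA.
have [all_fix|/existsNP [t /not_implyP [Ht ntg]]] := pselect (forall s, H s ->
  s g = g).
  exists (n' 0%N) => s Hs.
  by rewrite prodE expr0 mul1r all_fix.
exists (n' 1%N) => s Hs; rewrite prodE expr1.
have tg : t g = - g by case: (sg _ Ht).
have ta : t a = - a.
  have [|ta|//] := Hl a t _ Ht; first by rewrite inE eqxx.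
  by case: ntg; apply: hn.
rewrite rmorphM; have [|sa|sa] := Hl a s _ Hs; first by rewrite inE eqxx.
  by rewrite sa hn.
(* Both s and t negate a, so their composite stabilises it. *)
have : (s \o t) g = g.
  apply: hn; split; first exact: Hcomp.
  by rewrite /= ta rmorphN sa opprK.
by rewrite /= tg rmorphN sa => e; rewrite -{2}e mulrN mulNr.
Qed.

(** An ultrafilter selects one block of a finite partition, here that of the fibres of f. *)
Lemma ultra_finite_range (T : Type) (U : eqType) (F : set_system T) (f : T -> U)
    (r : seq U) : UltraFilter F -> (forall t, f t \in r) ->
  exists y, F [set t | f t = y].
Proof.
move=> FU fr; have : F [set t | f t \in r].
  by apply: filterS filterT => t _; exact: fr.
elim: r {fr} => [|y r IHr] Fr.
  by case: (filter_not_empty F); apply: filterS Fr.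
have [Fy|Fny] := in_ultra_setVsetC [set t | f t = y] FU; first by exists y.
apply: IHr; apply: filterS (filterI Fr Fny) => t [/=].
by rewrite inE => /predU1P [].
Qed.

(** * Limits of automorphisms along an ultrafilter *)

Section GaloisLimit.
Variables (K : fieldExtType rat) (iota : {rmorphism K -> algC}).
Variable s : nat -> {rmorphism algC -> algC}.
Hypothesis hs : forall n, abs_galois iota (s n).

(** The values at x lie among the roots of its minimal polynomial, so a limit exists; ring
    identities pass to it because F is stable under finite intersections. As F contains all tails,
    the limit is approached at arbitrarily large indices. *)
Lemma galois_limit : exists (F : set_system nat) (t : {rmorphism algC -> algC}),
  [/\ ProperFilter F, \oo `<=` F, abs_galois iota t
    & forall x, F [set n | s n x = t x]].
Proof.
have [F [FU oF]] := ultraFilterLemma eventually_filter.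
exists F; have FP : ProperFilter F by exact: ultra_proper.
have lim x : exists y, F [set n | s n x = y].
  have [p [_ mp] /(_ p) rx] := minCpolyP x; rewrite dvdpp in rx.
  have [r Dr] := closed_field_poly_normal (map_poly ratr p : {poly algC}).
  apply: (@ultra_finite_range _ _ _ _ r) => // n.
  rewrite lead_coef_map (monicP mp) rmorph1 scale1r in Dr.
  rewrite -root_prod_XsubC -Dr /root -(rat_poly_map (s n)).
  by rewrite (eqP (rx : root _ _)) rmorph0.
pose t x := projT1 (cid (lim x)).
have ht x : F [set n | s n x = t x] by rewrite /t; case: cid.
have uniq x y : F [set n | s n x = y] -> t x = y.
  by move=> h; have [n [/= <- <-]] := filter_ex (filterI (ht x) h).
have tB : zmod_morphism t.
  move=> x y; apply: uniq;
    apply: filterS (filterI (ht x) (ht y)) => n [/= hx hy].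
  by rewrite rmorphB hx hy.
have tM : monoid_morphism t.
  split; first by apply: uniq; apply: filterS filterT => n _ /=;
    rewrite rmorph1.
  move=> x y; apply: uniq;
    apply: filterS (filterI (ht x) (ht y)) => n [/= hx hy].
  by rewrite rmorphM hx hy.
pose tBM := GRing.isZmodMorphism.Build _ _ t tB.
pose tMM := GRing.isMonoidMorphism.Build _ _ t tM.
pose tR : {rmorphism algC -> algC} := HB.pack t tBM tMM.
exists tR; split=> //; apply: abs_galoisP => x; apply: uniq.
by apply: filterS filterT => n _ /=; case: (hs n) => _ ->.
Qed.

End GaloisLimit.

(** * The Galois representation *)

Lemma map_add_point (F L : fieldType) (f : {rmorphism F -> L}) (E :
  weierstrass F)
    (P Q : ecpoint F) :
  map_point f (add_point E P Q) =
  add_point (map_weierstrass f E) (map_point f P) (map_point f Q).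
Proof.
case: P Q => [[x1 y1]|] [[x2 y2]|] //=.
rewrite (inj_eq (fmorph_inj f)); set c := f y1 + f y2 + _ + _.
have -> : c = f (y1 + y2 + a1 E * x2 + a3 E) by rewrite /c; ring.
rewrite fmorph_eq0; case: ifP => //= _.
set l := if _ then _ else _; set l' := if _ then _ else _.
have <- : f l = l'.
  rewrite /l /l'; case: eqP => _; rewrite fmorph_div; congr (_ / _); ring.
by congr (Some (_, _)); ring.
Qed.

Lemma map_on_curve (F L : fieldType) (f : {rmorphism F -> L}) (E : weierstrass
  F)
    (P : ecpoint F) : on_curve E P -> on_curve (map_weierstrass f E)
      (map_point f P).
Proof.
case: P => [[x y]|] //= /eqP /(congr1 f) e; apply/eqP.
transitivity (f (y ^+ 2 + a1 E * x * y + a3 E * y)); first by ring.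
by rewrite e; ring.
Qed.

Lemma integral_embedding (K : fieldExtType rat) (iota : {rmorphism K -> algC}) :
  integralRange iota.
Proof.
move=> z; have [p mp rz] := algC_algebraic z.
exists (map_poly (in_alg K) p); first by rewrite map_monic.
rewrite -map_poly_comp;
  have -> // : map_poly (iota \o in_alg K) p = map_poly ratr p.
by apply: eq_map_poly => a /=; rewrite rmorphZ_num rmorph1 mulr1.
Qed.

Lemma two_neq0_algC : (2%:R : algC) != 0.
Proof. by rewrite Num.Theory.pnatr_eq0. Qed.

Lemma z2_one_odd (d : Z2) : 1 <> 2%:R * d.
Proof.
move=> h; have := z2_valM 2%:R d 0; rewrite -h.
by have -> : z2_res 2%:R 0 = 0 by apply: val_inj.
Qed.

(** * The square root of x(2P) - u on the group of points *)

Section HalfRoot.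
Variables (F : fieldType) (E : ecurve F) (u v w : F).
Hypothesis two_neq0 : (2%:R : F) != 0.
Hypothesis hs : split_by E u v w.
Implicit Types P T : ecgroup E.

(** The value 0 at infinity is a default; division by zero gives 0 at points of order 2 as well. *)
Definition hroot P : F :=
  if ecval P is Some (x, y) then half_root E u v w x y else 0.

Lemma two_torsion_vert P x y : ecval P = Some (x, y) ->
  (P *+ 2 == 0) = (vert E x y == 0).
Proof.
move=> eP; rewrite -val_eqE mulr2n /= eP /= eqxx /=.
have -> : y + y + a1 E * x + a3 E = vert E x y by rewrite /vert; ring.
by case: (vert E x y == 0).
Qed.

Lemma non_two_torsion P : P *+ 2 != 0 ->
  exists x y, ecval P = Some (x, y) /\ vert E x y != 0.
Proof.
case eP: (ecval P) => [[x y]|].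
  by rewrite (two_torsion_vert eP) => h; exists x, y.
have -> : P = 0 by apply: val_inj.
by rewrite mul0rn eqxx.
Qed.

Lemma hroot_sqr P x y : ecval (P *+ 2) = Some (x, y) -> hroot P ^+ 2 = x - u.
Proof.
move=> e2; have [|x0 [y0 [eP n0]]] := @non_two_torsion P.
  by apply: contra_eq_neq e2 => ->.
have hP := ecvalP P; rewrite eP in hP.
have [y' e'] := double_point two_neq0 hs hP n0.
move: e2; rewrite mulr2n ecvalD eP e' => -[<- _].
by rewrite /hroot eP addrC addKr.
Qed.

Lemma hroot_addu P T y : P *+ 2 != 0 -> T *+ 2 = 0 -> ecval T = Some (u, y) ->
  hroot (P + T) = hroot P.
Proof.
move=> P2 /eqP T2 eT; have [x0 [y0 [eP n0]]] := non_two_torsion P2.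
have hP := ecvalP P; rewrite eP in hP.
rewrite (two_torsion_vert eT) in T2.
have [x' [y' [e' _ h]]] := half_root_addu two_neq0 hs (ecurveP E) hP n0 (eqP
  T2).
by rewrite /hroot ecvalD eT eP e'.
Qed.

Lemma hroot_addv P T y : P *+ 2 != 0 -> T *+ 2 = 0 -> ecval T = Some (v, y) ->
  hroot (P + T) = - hroot P.
Proof.
move=> P2 /eqP T2 eT; have [x0 [y0 [eP n0]]] := non_two_torsion P2.
have hP := ecvalP P; rewrite eP in hP.
rewrite (two_torsion_vert eT) in T2.
have [x' [y' [e' _ h]]] := half_root_addv two_neq0 hs (ecurveP E) hP n0 (eqP
  T2).
by rewrite /hroot ecvalD eT eP e'.
Qed.

(** Doubling to abscissa u forces [hroot] to vanish at P, hence its numerator. *)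
Lemma four_torsion_x P x y yu : ecval (P *+ 2) = Some (u, yu) ->
  ecval P = Some (x, y) -> (x - u) ^+ 2 = (u - v) * (u - w).
Proof.
move=> e2 eP; have := hroot_sqr e2; rewrite subrr /hroot eP => /eqP.
have n0 : vert E x y != 0.
  by rewrite -(two_torsion_vert eP); apply: contra_eq_neq e2 => ->.
by rewrite expf_eq0 /= mulf_eq0 invr_eq0 (negbTE n0) orbF subr_eq0 => /eqP.
Qed.

Lemma hroot_addu_bool P T y (p : bool) : P *+ 2 != 0 -> T *+ 2 = 0 ->
  ecval T = Some (u, y) -> hroot (P + T *+ p) = hroot P.
Proof.
by case: p => P2 T2 eT; [exact: (hroot_addu P2 T2 eT)|rewrite mulr0n addr0].
Qed.

Lemma hroot_addv_bool P T y (p : bool) : P *+ 2 != 0 -> T *+ 2 = 0 ->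
  ecval T = Some (v, y) -> hroot (P + T *+ p) = (-1) ^+ p * hroot P.
Proof.
case: p => P2 T2 eT; last by rewrite mulr0n addr0 mul1r.
by rewrite mulr1n (hroot_addv P2 T2 eT) mulN1r.
Qed.

End HalfRoot.

Lemma sqr_eq_sign (F : idomainType) (x y : F) : x ^+ 2 = y ^+ 2 -> x = y \/ x
  = - y.
Proof. by move=> /eqP; rewrite eqf_sqr => /orP [] /eqP; [left|right]. Qed.

(** Otherwise every automorphism fixing i, a, b, c fixes r, and [sign_character] makes r times a
    monomial in them Galois invariant. That product lies in K, and its square is excluded by the
    last hypothesis. *)
Lemma exists_twist (K : fieldExtType rat) (iota : {rmorphism K -> algC})
    (u v w : K) (a b c r i : algC) :
    a ^+ 2 = iota (u - v) -> b ^+ 2 = iota (u - w) -> c ^+ 2 = iota (v - w) ->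
    r ^+ 2 = 2%:R -> i ^+ 2 = -1 ->
    (forall (s : bool) n1 n2 n3 x, x ^+ 2 <>
      (-1) ^+ s * 2%:R * ((u - v) ^+ n1 * (u - w) ^+ n2 * (v - w) ^+ n3)) ->
  exists2 s, abs_galois iota s &
    [/\ s i = i, s a = a, s b = b, s c = c & s r = - r].
Proof.
move=> ha hb hc hr hi nsq; apply: contrapT => none.
have sgn s x y : abs_galois iota s -> x ^+ 2 = iota y -> s x = x \/ s x = - x.
  by move=> [_ hs] hx; apply: sqr_eq_sign; rewrite -rmorphXn hx hs.
have hi' : i ^+ 2 = iota (-1) by rewrite hi rmorphN1.
have hr' : r ^+ 2 = iota 2%:R by rewrite hr rmorph_nat.
have [||||n hn] := @sign_character (abs_galois iota) [:: i; a; b; c] r.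
- exact: abs_galois_comp.
- move=> x s; rewrite !inE => /or4P [] /eqP -> Hs;
    [exact: sgn hi'|exact: sgn ha|exact: sgn hb|exact: sgn hc].
- by move=> s Hs; exact: sgn hr'.
- move=> s Hs fix_l; case: (sgn _ _ _ Hs hr') => // sr; case: none.
  by exists s => //; split=> //; apply: fix_l; rewrite !inE eqxx ?orbT.
have [x hx] := galois_fixed hn.
(* Squaring turns the power of i into a power of -1, of which only the parity of the exponent
   matters. *)
case: (nsq (odd (n 0)) (n 1) (n 2) (n 3) x); apply: (fmorph_inj iota).
rewrite rmorphXn hx !big_ord_recl big_ord0 /= mulr1.
rewrite !rmorphM !(rmorphXn iota) -ha -hb -hc rmorphN1 rmorph_nat signr_odd
  -hi -hr.
by rewrite !(exprAC _ 2); ring.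
Qed.

Lemma z2_bit (a : Z2) : exists (p : bool) b, a = p%:R + 2%:R * b.
Proof.
by have [b [->|->]] := z2_parity a; [exists false, b;
  rewrite add0r|exists true, b].
Qed.

Lemma mulz2_bit (V : zmodType) (x : V) (p : bool) b : x *+ 2 = 0 ->
  x *+ z2_res (p%:R + 2%:R * b) 1 = x *+ p.
Proof.
move=> x0; have x1 : x *+ 2 ^ 1 = 0 by [].
by rewrite mulz2D // mulz2M // !mulz2_nat // x0 mul0rn addr0.
Qed.

(** * The image of Galois on the Tate module *)

Section TwoAdicImage.
Variables (K : fieldExtType rat) (iota : {rmorphism K -> algC}).
Variables (E : weierstrass K) (hE : elliptic E).
Local Notation EL := (map_weierstrass iota E).

Lemma base_change_disc : discriminant EL != 0.
Proof. by rewrite map_discriminant fmorph_eq0. Qed.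

Let G := ECurve base_change_disc.

Section GaloisAction.
Variables (s : {rmorphism algC -> algC}) (hs : abs_galois iota s).

Lemma map_weierstrass_fix : map_weierstrass s EL = EL.
Proof. by case: hs => _ h; rewrite /map_weierstrass /= !h. Qed.

Lemma gal_point_on_curve (P : ecgroup G) : on_curve G (map_point s P).
Proof.
by have := map_on_curve s (ecvalP P); rewrite /= map_weierstrass_fix.
Qed.

Definition gal_point (P : ecgroup G) : ecgroup G := ECGroup
  (gal_point_on_curve P).

Fact gal_point_is_zmod_morphism : zmod_morphism gal_point.
Proof.
have addf (P Q : ecgroup G) : gal_point (P + Q) = gal_point P + gal_point Q.
  by apply: val_inj => /=; rewrite map_add_point /= map_weierstrass_fix.
by move=> P Q; apply: (addIr (gal_point Q)); rewrite -addf !subrK.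
Qed.

HB.instance Definition _ := GRing.isZmodMorphism.Build (ecgroup G) (ecgroup G)
  gal_point gal_point_is_zmod_morphism.

End GaloisAction.

Variable e : 'I_2 -> nat -> ecpoint algC.
Hypothesis he : tate_basis EL e.

Let eP (i : 'I_2) (n : nat) : ecgroup G :=
  @ECGroup _ G (e i n) (proj1 ((proj2 (proj1 he i)) n)).

Lemma tate_eP i : tate (eP i).
Proof.
case: he => h _; case: (h i) => e0 eS; split=> [|n]; apply: val_inj.
  exact: e0.
by case: (eS n) => _ e2; rewrite -[\val (eP i n)]e2; exact: (ecval_mul 2).
Qed.

Lemma tate_combE c n : tate_comb EL e c n = comb eP c n.
Proof. by rewrite /comb ecvalD !ecval_mul. Qed.

Lemma basis_eP (t : nat -> ecgroup G) : tate t -> exists! c, comb eP c = t.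
Proof.
case=> t0 tS; case: he => _ /(_ (fun n => ecval (t n))) [].
  split=> [|n]; first by rewrite t0.
  split; first exact: ecvalP.
  by rewrite -(ecval_mul 2 (t n.+1)) tS.
move=> c [hc uc]; exists c; split.
  apply: funext => n; apply: val_inj.
  by apply: etrans (esym (tate_combE c n)) _; rewrite hc.
by move=> d hd; apply: uc; apply: funext => n; rewrite tate_combE hd.
Qed.

Lemma galois_rep_acts s (hs : abs_galois iota s) :
  acts eP (gal_point hs) (galois_rep iota E e s).
Proof.
have [M hM] := acts_ex tate_eP basis_eP (gal_point hs).
suff -> : galois_rep iota E e s = M by [].
apply/matrixP => i j; rewrite mxE.
suff -> : tate_coord EL e (fun n => map_point s (e j n)) = col j M by rewrite
  mxE.
have tE : tate_comb EL e (col j M) = (fun n => map_point s (e j n)).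
  by apply: funext => n; rewrite tate_combE -hM.
apply: (comb_inj tate_eP basis_eP) => n; apply: val_inj.
apply: etrans (esym (tate_combE _ n)) _; apply: etrans (tate_combE _ n).
(* The default of [xget] is not reached, since [col j M] is a coordinate vector. *)
rewrite tE /tate_coord; case: xgetP => [c _ /= ->|/(_ (col j M))] //.
Qed.

Lemma gal_hroot s (hs : abs_galois iota s) (u v w : K) (P : ecgroup G) :
  hroot (iota u) (iota v) (iota w) (gal_point hs P) =
  s (hroot (iota u) (iota v) (iota w) P).
Proof.
rewrite /hroot /=; case: (ecval P) => [[x y]|] /=; last by rewrite rmorph0.
case: hs => _ h; rewrite /half_root fmorph_div; congr (_ / _).
  by rewrite !(rmorphB, rmorphXn, rmorphM) !h.
by rewrite /vert /= !rmorphD !rmorphM rmorph_nat !h.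
Qed.

Hypothesis hE2 : full_torsion E 2.

Lemma two_torsion_rational (P : ecgroup G) : P *+ 2 = 0 ->
  exists2 Q, on_curve E Q & map_point iota Q = ecval P.
Proof.
move=> P2; apply: (hE2 (integral_embedding iota)); split; first exact: ecvalP.
by apply: etrans (esym (ecval_mul 2 P)) _; rewrite P2.
Qed.

Lemma gal_fix_two_torsion s (hs : abs_galois iota s) (P : ecgroup G) :
  P *+ 2 = 0 -> gal_point hs P = P.
Proof.
move=> /two_torsion_rational [Q _ eQ]; apply: val_inj; rewrite /= -eQ.
by case: Q {eQ} => [[x y]|] //=; case: (hs) => _ h; rewrite !h.
Qed.

Lemma galois_rep_V2 s : abs_galois iota s -> V2 1 (galois_rep iota E e s).
Proof.
move=> hs; have [|X ->] := acts_fix tate_eP basis_eP (n := 1) (galois_rep_acts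
  hs).
  by move=> j; apply: gal_fix_two_torsion; exact: (basis_torsion tate_eP j 1).
by exists X.
Qed.

Lemma basis2_neq0 j : eP j 1 != 0.
Proof.
apply/eqP => h; have [|d] := comb_eq0 tate_eP basis_eP (c := delta_mx j 0) (n
  := 1).
  by rewrite comb_delta; [exact: h|exact: tate_eP].
move/(congr1 (fun c : 'cV_2 => c j 0)); rewrite !mxE !eqxx; exact: z2_one_odd.
Qed.

Lemma basis2_neq : eP 0 1 != eP 1 1.
Proof.
apply/eqP => h.
have [|d] := comb_eq tate_eP basis_eP (c := delta_mx 0 0) (d := delta_mx 1 0)
  (n := 1).
  by rewrite !comb_delta; [exact: h|exact: tate_eP|exact: tate_eP].
move/(congr1 (fun c : 'cV_2 => c 0 0)); rewrite !mxE /= add0r;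
  exact: z2_one_odd.
Qed.

Lemma basisS j n : eP j n.+1 *+ 2 = eP j n.
Proof. by case: (tate_eP j). Qed.

(** The first level of the basis consists of two distinct rational points of order 2; their
    abscissas differ because [vert] vanishes at both and so determines the ordinate. *)
Lemma basis2_split : exists u v w yu yv, split_by E u v w /\
  ecval (eP 0 1) = Some (iota u, yu) /\ ecval (eP 1 1) = Some (iota v, yv).
Proof.
have aff j : exists x y, [/\ on_curve E (Some (x, y)), vert E x y = 0 &
    ecval (eP j 1) = Some (iota x, iota y)].
  have t2 : eP j 1 *+ 2 = 0 by exact: (basis_torsion tate_eP j 1).
  have [[[x y]|] hQ /= eQ] := two_torsion_rational t2; last first.
    by case/eqP: (basis2_neq0 j); apply: val_inj; exact: esym eQ.
  exists x, y; split=> //.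
  apply: (fmorph_inj iota); rewrite rmorph0 -map_vert.
  have eP1 : ecval (eP j 1) = Some (iota x, iota y) by exact: esym eQ.
  by apply/eqP; rewrite -[_ == 0](two_torsion_vert eP1) t2.
have [u [yu [hu vu eu]]] := aff 0; have [v [yv [hv vv ev]]] := aff 1.
have two : (2%:R : K) != 0 by rewrite -(fmorph_eq0 iota) rmorph_nat
  two_neq0_algC.
have uv : u != v.
  apply: contraNneq basis2_neq => uv; apply/eqP/val_inj.
  apply: etrans eu _; apply: etrans _ (esym ev); rewrite uv.
  congr (Some (_, iota _)); apply: (mulfI two); move: vu vv.
  rewrite /vert uv -!addrA => /eqP; rewrite addr_eq0 => /eqP ->.
  by move=> /eqP; rewrite addr_eq0 => /eqP ->.
have [w hw] := two_torsion_split two hu hv vu vv uv.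
by exists u, v, w, (iota yu), (iota yv).
Qed.

Hypothesis nsq : forall u v w, split_by E u v w ->
  forall (s : bool) n1 n2 n3 x, x ^+ 2 <>
    (-1) ^+ s * 2%:R * ((u - v) ^+ n1 * (u - w) ^+ n2 * (v - w) ^+ n3).

Lemma odd_trace_element : exists X b,
  (exists2 s, abs_galois iota s & galois_rep iota E e s = 1%:M + 4%:R *: X) /\
  X 0 0 + X 1 1 = 1 + 2%:R * b.
Proof.
have [u [v [w [yu [yv [hs [eT0 eT1]]]]]]] := basis2_split.
have two := two_neq0_algC.
pose U := iota u; pose V := iota v; pose W := iota w.
have hsL : split_by G U V W := map_split iota hs.
have [uv uw vw] := split_neq two hsL base_change_disc.
have aff j : exists x y, ecval (eP j 2) = Some (x, y).
  have [|x [y [h _]]] := @non_two_torsion _ G (eP j 2); last by exists x, y.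
  by rewrite basisS basis2_neq0.
have [x0 [y0 eP0]] := aff 0; have [x1 [y1 eP1]] := aff 1.
have hx0 : (x0 - U) ^+ 2 = (U - V) * (U - W).
  by apply: (four_torsion_x two hsL (P := eP 0 2) _ eP0); rewrite basisS;
    exact: eT0.
have hx1 : (x1 - V) ^+ 2 = (V - U) * (V - W).
  apply: (four_torsion_x two (split_byC12 hsL) (P := eP 1 2) _ eP1).
  by rewrite basisS; exact: eT1.
have [a ha] := closed_sqrt (U - V); have [i hi] := closed_sqrt (-1 : algC).
have [r hr] := closed_sqrt (2%:R : algC).
have a0 : a != 0 by rewrite -sqrf_eq0 ha.
have i0 : i != 0 by rewrite -sqrf_eq0 hi oppr_eq0 oner_eq0.
(* Defining b and c as quotients fixes the signs of these square roots, so that x0 = U + a b and x1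
   = V + i a c for the given basis. *)
pose b := (x0 - U) / a; pose c := (x1 - V) / (i * a).
have hb : b ^+ 2 = U - W by rewrite expr_div_n hx0 ha; field.
have hc : c ^+ 2 = V - W.
  by rewrite expr_div_n hx1 exprMn ha hi; field.
have ex0 : x0 = U + a * b by rewrite /b; field.
have ex1 : x1 = V + i * a * c by rewrite /c; field; rewrite a0 i0.
clearbody b c.
have [|||s Hs [si sa sb sc sr]] := @exists_twist K iota u v w a b c r i _ _ _
  hr hi (nsq hs).
- by rewrite ha rmorphB.
- by rewrite hb rmorphB.
- by rewrite hc rmorphB.
have sK y : s (iota y) = iota y by case: (Hs) => _; apply.
(* By the curve equation [vert] is 2 t up to sign, so fixing x and t fixes the ordinate. *)
have fixP j x y t : ecval (eP j 2) = Some (x, y) -> s x = x ->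
    (x - U) * (x - V) * (x - W) = t ^+ 2 -> s t = t ->
    gal_point Hs (eP j 2) = eP j 2.
  move=> ePj sx ht st; have hP := ecvalP (eP j 2); rewrite ePj in hP.
  have sv : s (vert EL x y) = vert EL x y.
    move: hP; rewrite (on_curve_split two _ _ hsL) ht => /eqP hv.
    have : vert EL x y ^+ 2 = (2%:R * t) ^+ 2 by rewrite [LHS]hv; ring.
    by case/sqr_eq_sign => ->; rewrite ?rmorphN rmorphM st rmorph_nat.
  apply: val_inj; change (map_point s (ecval (eP j 2)) = ecval (eP j 2)).
  rewrite ePj /= sx; congr (Some (_, _)).
  move: sv; rewrite /vert /= !rmorphD !rmorphM rmorph_nat !sK sx.
  by move=> /addIr /addIr /(mulfI two).
have sx0 : s x0 = x0 by rewrite ex0 rmorphD sK rmorphM sa sb.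
have sx1 : s x1 = x1 by rewrite ex1 rmorphD sK !rmorphM si sa sc.
have fixP0 : gal_point Hs (eP 0 2) = eP 0 2.
  apply: (fixP 0 x0 y0 (a * b * (a + b))) => //.
    transitivity ((a * b) * ((U - V) + a * b) * ((U - W) + a * b)).
      by rewrite ex0; ring.
    by rewrite -ha -hb; ring.
  by rewrite !rmorphM rmorphD sa sb.
have fixP1 : gal_point Hs (eP 1 2) = eP 1 2.
  apply: (fixP 1 x1 y1 (i * a * c * (c + i * a))) => //.
    transitivity ((i * a * c - (U - V)) * (i * a * c) * ((V - W) + i * a * c)).
      by rewrite ex1; ring.
    have -> : U - V = - (i * a) ^+ 2 by rewrite exprMn hi ha; ring.
    by rewrite -hc; ring.
  by rewrite !rmorphM rmorphD rmorphM si sa sc.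
have [|X hX] := acts_fix tate_eP basis_eP (n := 2) (galois_rep_acts Hs).
  by move=> j; case: (ord2P j) => ->.
(* Multiplication by 4 sends level 3 to level 1, so the part 4 X of the matrix translates a point of
   order 8 by a 2-torsion point. *)
have sQ j : gal_point Hs (eP j 3) = eP j 3 + comb eP (col j X) 1.
  rewrite (galois_rep_acts Hs) hX.
  have -> : col j (1%:M + (2 ^ 2)%:R *: X) = delta_mx j 0 + (2 ^ 2)%:R *: col
    j X.
    by apply/matrixP => k l; rewrite !mxE [l]ord1 eqxx andbT.
  rewrite combD; [|exact: tate_eP]; rewrite comb_delta; [|exact: tate_eP].
  by rewrite combZn ?(comb_shift tate_eP _ 1 2) //; exact: tate_eP.
have T2 j : eP j 1 *+ 2 = 0 by exact: (basis_torsion tate_eP j 1).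
have [p00 [b00 e00]] := z2_bit (X 0 0); have [p10 [b10 e10]] := z2_bit (X 1 0).
have [p01 [b01 e01]] := z2_bit (X 0 1); have [p11 [b11 e11]] := z2_bit (X 1 1).
have P20 : eP 0 3 *+ 2 != 0.
  by rewrite basisS; apply: contraNneq (basis2_neq0 0) => h;
    rewrite -basisS h mul0rn.
have P21 : eP 1 3 *+ 2 != 0.
  by rewrite basisS; apply: contraNneq (basis2_neq0 1) => h;
    rewrite -basisS h mul0rn.
(* The square roots of x0 - V and x1 - U. Swapping U and V in [r0] makes each one insensitive to the
   off-diagonal entry of X: only [p00] and [p11] change signs. *)
pose r0 := hroot (E := G) V U W (eP 0 3);
  pose r1 := hroot (E := G) U V W (eP 1 3).
have sr0 : s r0 = (-1) ^+ p00 * r0.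
  rewrite /r0 -(gal_hroot Hs) sQ /comb !mxE e00 e10 !mulz2_bit // addrA addrAC.
  rewrite (hroot_addv_bool two (split_byC12 hsL) _ _ (T2 0) eT0); last first.
    by rewrite mulrnDl mulrnAC T2 mul0rn addr0.
  by rewrite (hroot_addu_bool two (split_byC12 hsL) _ P20 (T2 1) eT1).
have sr1 : s r1 = (-1) ^+ p11 * r1.
  rewrite /r1 -(gal_hroot Hs) sQ /comb !mxE e01 e11 !mulz2_bit // addrA.
  rewrite (hroot_addv_bool two hsL _ _ (T2 1) eT1); last first.
    by rewrite mulrnDl mulrnAC T2 mul0rn addr0.
  by rewrite (hroot_addu_bool two hsL _ P21 (T2 0) eT0).
have r0_sqr : r0 ^+ 2 = x0 - V.
  by apply: (@hroot_sqr _ G V U W two (split_byC12 hsL) _ x0 y0);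
    rewrite basisS.
have r1_sqr : r1 ^+ 2 = x1 - U.
  by apply: (@hroot_sqr _ G U V W two hsL _ x1 y1); rewrite basisS.
have hbc : b ^+ 2 = a ^+ 2 + c ^+ 2 by rewrite ha hb hc; ring.
have c0 : c ^+ 2 != 0 by rewrite hc.
have b0 : b ^+ 2 != 0 by rewrite hb.
have r_neq0 : r != 0 by rewrite -sqrf_eq0 hr.
have rho0 : r0 * r1 != 0.
  rewrite -sqrf_eq0 exprMn r0_sqr r1_sqr.
  have -> : x0 - V = a * (a + b) by rewrite mulrDr -expr2 ha ex0; ring.
  have -> : x1 - U = i * a * (c + i * a).
    transitivity (i ^+ 2 * a ^+ 2 + i * a * c); last by ring.
    by rewrite hi ha ex1; ring.
  rewrite !mulf_neq0 //.
    apply: contraNneq c0 => /eqP; rewrite addr_eq0 => /eqP ab; apply/eqP.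
    by apply: (addrI (a ^+ 2)); rewrite -hbc addr0 ab sqrrN.
  apply: contraNneq b0 => /eqP; rewrite addr_eq0 => /eqP cia; apply/eqP.
  by rewrite hbc cia sqrrN exprMn hi; ring.
have [t [st rho_t]] : exists t, s t = - t /\ r0 * r1 = t.
  (* As b^2 = a^2 + c^2, both z^2 and (x0 - V) (x1 - U) equal - a^2 (a + b) (a - i c); the only
     square root in z that s negates is r. *)
  pose z := i * a * (a + b - i * c) / r.
  have sz : s z = - z.
    by rewrite fmorph_div sr !rmorphM rmorphB rmorphD rmorphM si sa sb sc
      invrN mulrN.
  have : (r0 * r1) ^+ 2 = z ^+ 2.
    rewrite exprMn r0_sqr r1_sqr expr_div_n hr.
    have -> : x0 - V = a ^+ 2 + a * b by rewrite ex0 ha; ring.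
    have -> : x1 - U = - a ^+ 2 + i * a * c by rewrite ex1 ha; ring.
    have -> : (i * a * (a + b - i * c)) ^+ 2 =
        i ^+ 2 * a ^+ 2 * (a ^+ 2 + b ^+ 2 + i ^+ 2 * c ^+ 2 + 2%:R * a * b
          - 2%:R * i * a * c - 2%:R * i * b * c) by ring.
    by rewrite hbc hi; field.
  case/sqr_eq_sign => ->; [by exists z|exists (- z); by rewrite rmorphN sz].
have : (-1) ^+ p00 * (-1) ^+ p11 * (r0 * r1) = - (r0 * r1).
  by rewrite mulrACA -sr0 -sr1 -rmorphM rho_t st.
move=> hsign; exists X, (b00 + b11); split; first by exists s.
have nz : r0 * r1 <> - (r0 * r1).
  move=> /eqP; rewrite -addr_eq0 -mulr2n -mulr_natl mulf_eq0 (negbTE two).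
  by rewrite (negbTE rho0).
rewrite e00 e11; case: p00 p11 {sr0 sr1 e00 e11} hsign => [] [] /= hsign;
  try ring.
  by case: nz; rewrite -[RHS]hsign; ring.
by case: nz; rewrite -[RHS]hsign; ring.
Qed.

Hypothesis hsurj : forall M, V2 1 M -> exists2 s, abs_galois iota s &
  exists2 N, V2 2 N & galois_rep iota E e s = M *m N.

Let S (M : 'M[Z2]_2) := exists2 s, abs_galois iota s & galois_rep iota E e s =
  M.

Lemma galois_repM s t : abs_galois iota s -> abs_galois iota t ->
  galois_rep iota E e (s \o t) = galois_rep iota E e s *m galois_rep iota E e t.
Proof.
move=> hs ht; apply: (acts_uniq tate_eP basis_eP)
  (galois_rep_acts (abs_galois_comp hs ht)) _.
have h := actsM tate_eP (galois_rep_acts hs) (galois_rep_acts ht).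
move=> j n; rewrite -h; apply: val_inj => /=.
by case: (e j n) => [[x y]|].
Qed.

Lemma image_mul M N : S M -> S N -> S (M * N).
Proof.
move=> [s hs <-] [t ht <-]; exists (s \o t); first exact: abs_galois_comp.
exact: galois_repM.
Qed.

Lemma image_inv M : S M -> exists2 N, S N & M * N = 1.
Proof.
move=> [s hs <-]; have ht := abs_galois_inv hs.
exists (galois_rep iota E e (algC_invaut s)); first by exists (algC_invaut s).
apply: etrans (esym (galois_repM hs ht)) _.
apply: (acts_uniq tate_eP basis_eP) (galois_rep_acts (abs_galois_comp hs ht)) _.
move=> j n; rewrite -(acts1 tate_eP); apply: val_inj => /=.
by case: (e j n) => [[x y]|] //=; rewrite !algC_invautK.
Qed.

Lemma image_mod4 X : exists2 M, S M & exists Y, M = 1 + 2%:R *: X + 4%:R *: Y.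
Proof.
have [|s hs [N [Y _ <-] eN]] := hsurj (M := 1 + 2%:R *: X).
  by exists X => //; rewrite expr1.
exists (galois_rep iota E e s); first by exists s.
exists (Y + 2%:R *: (X * Y)); rewrite eN -[_ *m _]/(_ * _) -natrX mul_1Z.
by rewrite scalerDr scalerA [_ * 2%:R]mulrC addrA.
Qed.

Lemma image_V2 : galois_rep iota E e @` abs_galois iota = V2 1.
Proof.
apply/seteqP; split=> [_ [s hs <-]|M [X _ eM]]; first exact: galois_rep_V2.
have [B [b [SB tB]]] := odd_trace_element.
have full : forall Y, exists2 N, S N & exists Z, N = 1 + 4%:R *: Y + 8%:R *: Z.
  apply: (layer2_full image_mul image_mod4 _ tB);
    exists (1%:M + 4%:R *: B) => //.
  by exists 0; rewrite scaler0 addr0.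
have dense n : exists s, abs_galois iota s /\
    exists Y, M = galois_rep iota E e s + (2 ^ n.+1)%:R *: Y.
  have [|N [s hs eN] [Y eY]] :=
    density image_mul image_inv image_mod4 full n (M := M) (X := X).
    by rewrite -eM expr1.
  by exists s; split=> //; exists Y; rewrite eN.
have [s hs] := choice dense.
have [F [t [FP oF ht limt]]] := galois_limit (fun n => proj1 (hs n)).
exists t => //; apply: (acts_uniq tate_eP basis_eP) (galois_rep_acts ht) _.
move=> j n; apply: val_inj;
  change (map_point t (e j n) = ecval (comb eP (col j M) n)).
(* One index m serves three purposes: s m agrees with the limit at both coordinates of [e j n], and
   m is large enough for M and the matrix of s m to act alike on 2^n-torsion. *)
have [m [le_nm em]] : exists m, (n <= m)%N /\
    map_point (s m) (e j n) = map_point t (e j n).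
  have Fn : F [set m | (n <= m)%N] by apply: oF; exists n.
  case: (e j n) => [[x y]|] /=; last first.
    by have [m hm] := filter_ex Fn; exists m.
  have [m [[/= hm hx] hy]] := filter_ex (filterI (filterI Fn (limt x)) (limt
    y)).
  by exists m; rewrite hx hy.
rewrite -em; have [hsm [Y eY]] := hs m.
transitivity (ecval (comb eP (col j (galois_rep iota E e (s m))) n)).
  by rewrite -(galois_rep_acts hsm j n).
congr ecval; apply/esym;
  apply: (comb_congr tate_eP (x := col j Y) (m := m.+1)); last exact: leqW.
by rewrite eY; apply/matrixP => k l; rewrite !mxE.
Qed.

End TwoAdicImage.

Theorem proposition2p9
    (K : fieldExtType rat) (iota : {rmorphism K -> algC})
    (E : weierstrass K) (hE : elliptic E) (hE2 : full_torsion E 2)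
    (e : 'I_2 -> nat -> ecpoint algC)
    (he : tate_basis (map_weierstrass iota E) e)
    (hsurj : forall M, V2 1 M -> exists2 s, abs_galois iota s &
       exists2 N, V2 2 N & galois_rep iota E e s = M *m N)
    (hp : exists (p : {pred ring_of_integers K})
            (k : finFieldType) (red : {rmorphism ring_of_integers K -> k})
            (W : weierstrass (ring_of_integers K)),
       [/\ nonzero_prime p /\ residue_map p red,
           weierstrass_iso E (map_weierstrass (@integer_val K) W),
           2%:R * discriminant W \notin p,
           #|k| = 5 %[mod 8]
         & full_torsion (map_weierstrass red W) 4]) :
  galois_rep iota E e @` abs_galois iota = V2 1.
Proof.
apply: image_V2 => // u v w hs s n1 n2 n3 x.
exact: two_not_square_multiple hs hp s n1 n2 n3 x.
Qed.
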